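(* Let $q\in(0,n)$. If $K,L\subset\mathbb{R}^n$ are unconditional convex bodies, then for every $\lambda\in(0,1)$, $$\widetilde V_q\big((1-\lambda)\cdot K+_0\lambda\cdot L\big)\ge\widetilde V_q(K)^{1-\lambda}\,\widetilde V_q(L)^{\lambda}.$$ Moreover, equality holds if and only if $K$ and $L$ are dilates of one another.
   Context: Throughout $n\ge2$. A convex body is a compact convex subset of $\mathbb{R}^n$ with nonempty interior; it is unconditional if its support function is invariant under all coordinate reflections $x_i\mapsto-x_i$. $h_K$ denotes the support function of $K$. For $q>0$, $\widetilde V_q(K)=\frac qn\int_K|x|^{q-n}\,dx$ is the $q$-th dual quermassintegral. The $L_0$-sum is $$(1-\lambda)\cdot K+_0\lambda\cdot L=\{x\in\mathbb{R}^n:\langle x,y\rangle\le h_K(y)^{1-\lambda}h_L(y)^\lambda\ \ \forall y\in S^{n-1}\}.$$ $K$ and $L$ are dilates if $L=cK$ for some $c>0$. *)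

(* Defs.v *)
From HB Require Import structures.
From mathcomp Require Import all_boot all_order all_algebra.
From mathcomp Require Import all_classical all_reals all_analysis.

Set Implicit Arguments.
Unset Strict Implicit.
Unset Printing Implicit Defensive.

Import Order.TTheory GRing.Theory Num.Theory.
Import numFieldNormedType.Exports.

Local Open Scope classical_set_scope.
Local Open Scope ring_scope.

Definition measure_rV_display : measure_display -> measure_display.
Proof. exact. Qed.

Section measurable_rV.
Context {R : realType} {n : nat}.

Definition rV_coord (i : 'I_n) (x : 'rV[R]_n) : R := x ord0 i.

Let rV_set0 : g_sigma_preimage rV_coord set0.
Proof. exact: sigma_algebra0. Qed.

Let rV_setC A :
  g_sigma_preimage rV_coord A -> g_sigma_preimage rV_coord (~` A).
Proof. exact: sigma_algebraC. Qed.

Let rV_bigcup (F : (set _)^nat) : (forall i, g_sigma_preimage rV_coord (F i)) ->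
  g_sigma_preimage rV_coord (\bigcup_i (F i)).
Proof. exact: sigma_algebra_bigcup. Qed.

(* R^n carries the sigma-algebra generated by the coordinate maps, i.e. its
   Borel sigma-algebra, as the library does for [n.-tuple T]. *)
HB.instance Definition _ := @isMeasurable.Build
  (measure_rV_display default_measure_display) 'rV[R]_n
  (g_sigma_preimage rV_coord) rV_set0 rV_setC rV_bigcup.

Lemma measurable_rV_coord (i : 'I_n) :
  measurable_fun [set: 'rV[R]_n] (rV_coord i).
Proof.
move=> _ Y mY; rewrite setTI; apply: sub_sigma_algebra => /=.
rewrite -bigcup_seq/=; exists i => /=; first by rewrite mem_index_enum.
by exists Y => //; rewrite setTI.
Qed.

Lemma measurable_fun_rVP d (T : measurableType d) (f : T -> 'rV[R]_n) :
  measurable_fun [set: T] f <->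
  forall i, measurable_fun [set: T] (rV_coord i \o f).
Proof.
split=> [mf i|mf].
  by apply: measurableT_comp => //; exact: measurable_rV_coord.
suff sub : g_sigma_preimage rV_coord `<=`
    [set A | measurable (f @^-1` A)].
  by move=> _ A mA; rewrite setTI; exact: sub.
apply: smallest_sub.
  split => [|A mA|F mF] /=.
  - by rewrite preimage_set0.
  - by rewrite setTD preimage_setC; exact: measurableC.
  - by rewrite preimage_bigcup; exact: bigcupT_measurable.
rewrite -bigcup_seq => A [i _ [B mB <-]] /=.
rewrite setTI -comp_preimage -[X in measurable X]setTI.
exact: mf.
Qed.

End measurable_rV.


Section rV_cons.
Context {R : realType} {n : nat}.

Definition rV_cons (p : R * 'rV[R]_n) : 'rV[R]_n.+1 :=
  row_mx (const_mx p.1 : 'rV[R]_1) p.2.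

Definition rV_uncons (x : 'rV[R]_n.+1) : R * 'rV[R]_n :=
  (x ord0 ord0, rsubmx (x : 'rV[R]_(1 + n))).

Lemma rV_consK : cancel rV_cons rV_uncons.
Proof.
case=> a x; rewrite /rV_uncons /rV_cons row_mxKr/=; congr pair.
have E : lshift n ord0 = ord0 :> 'I_(1 + n) by exact/val_inj.
by have := row_mxEl (const_mx a : 'rV_1) x ord0 ord0; rewrite E [RHS]mxE.
Qed.

Lemma rV_cons0 p : rV_cons p ord0 ord0 = p.1.
Proof. by have /(congr1 fst) := rV_consK p. Qed.

Lemma rV_consS p (j : 'I_n) : rV_cons p ord0 (lift ord0 j) = p.2 ord0 j.
Proof.
have E : rshift 1 j = lift ord0 j :> 'I_(1 + n) by exact/val_inj.
by have := row_mxEr (const_mx p.1 : 'rV_1) p.2 ord0 j; rewrite E.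
Qed.

Lemma measurable_rV_cons : measurable_fun [set: R * 'rV[R]_n] rV_cons.
Proof.
apply/measurable_fun_rVP => i.
have [j ->|->] := unliftP ord0 i.
  rewrite [X in measurable_fun _ X](_ : _ = rV_coord j \o snd).
    by apply: measurableT_comp => //; exact: measurable_rV_coord.
  by apply/funext => p; exact: rV_consS.
rewrite [X in measurable_fun _ X](_ : _ = fst)//.
by apply/funext => p; exact: rV_cons0.
Qed.

Lemma measurable_rV_uncons : measurable_fun [set: 'rV[R]_n.+1] rV_uncons.
Proof.
apply: measurable_fun_pair; first exact: (measurable_rV_coord ord0).
apply/measurable_fun_rVP => i.
rewrite [X in measurable_fun _ X](_ : _ = rV_coord (rshift 1 i)).
  exact: measurable_rV_coord.
by apply/funext => x; rewrite /rV_coord /= mxE.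
Qed.

End rV_cons.

Section lebesgue_rV.
Local Open Scope ereal_scope.
Context {R : realType}.

Section succ.
Context {n : nat} (mu : {sigma_finite_measure set 'rV[R]_n -> \bar R}).

Definition lebesgue_rV_succ : set 'rV[R]_n.+1 -> \bar R :=
  pushforward (@lebesgue_measure R \x mu) rV_cons.

Let mcons := @measurable_rV_cons R n.

Let succ0 : lebesgue_rV_succ set0 = 0. Proof. exact: measure0. Qed.

Let succ_ge0 A : 0 <= lebesgue_rV_succ A. Proof. exact: measure_ge0. Qed.

Let succ_sigma_additive : semi_sigma_additive lebesgue_rV_succ.
Proof. exact: measure_semi_sigma_additive. Qed.

HB.instance Definition _ := isMeasure.Build _ _ _ lebesgue_rV_succ
  succ0 succ_ge0 succ_sigma_additive.

Let sigma_finite_succ : sigma_finite setT lebesgue_rV_succ.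
Proof.
have /sigma_finiteP[F [FT ndF Foo]] := sigma_finiteT (@lebesgue_measure R).
have /sigma_finiteP[G [GT ndG Goo]] := sigma_finiteT mu.
exists (fun k => rV_uncons @^-1` (F k `*` G k)).
  apply/esym; rewrite -subTset => x _.
  have [i _ Fi] : (\bigcup_i F i) (rV_uncons x).1 by rewrite -FT.
  have [j _ Gj] : (\bigcup_j G j) (rV_uncons x).2 by rewrite -GT.
  exists (maxn i j) => //; split.
    by move: Fi; exact/subsetPset/ndF/leq_maxl.
  by move: Gj; exact/subsetPset/ndG/leq_maxr.
move=> k; have [mF Fk] := Foo k; have [mG Gk] := Goo k; split.
  rewrite -[X in measurable X]setTI; apply: measurable_rV_uncons => //.
  exact: measurableX.
rewrite /lebesgue_rV_succ /pushforward -comp_preimage.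
rewrite (_ : _ \o _ = id) ?preimage_id; last first.
  by apply/funext => p; exact: rV_consK.
by rewrite product_measure1E// lte_mul_pinfty// ge0_fin_numE.
Qed.

HB.instance Definition _ :=
  Measure_isSigmaFinite.Build _ _ _ lebesgue_rV_succ sigma_finite_succ.

End succ.

(* n-dimensional Lebesgue measure, as the n-fold product of the one-dimensional
   one; R^0 has a single point, of mass 1. *)
Fixpoint lebesgue_rV (n : nat) :
    {sigma_finite_measure set 'rV[R]_n -> \bar R} :=
  match n with
  | 0 => dirac (0%R : 'rV[R]_0)
  | m.+1 => lebesgue_rV_succ (lebesgue_rV m)
  end.

Lemma lebesgue_rV_box n (a b : 'rV[R]_n) :
  (forall i, a ord0 i <= b ord0 i)%R ->
  lebesgue_rV n [set x | forall i, (a ord0 i <= x ord0 i <= b ord0 i)%R] =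
  (\prod_(i < n) (b ord0 i - a ord0 i))%:E.
Proof.
elim: n a b => [a b _|n ih a b ab].
  by rewrite big_ord0 /= diracE mem_set// => -[].
pose a' : 'rV[R]_n := (rV_uncons a).2; pose b' := (rV_uncons b).2.
have cons_a' j : a' ord0 j = a ord0 (lift ord0 j).
  by rewrite mxE; congr (a _ _); exact/val_inj.
have cons_b' j : b' ord0 j = b ord0 (lift ord0 j).
  by rewrite mxE; congr (b _ _); exact/val_inj.
have ab' i : (a' ord0 i <= b' ord0 i)%R by rewrite cons_a' cons_b'.
rewrite /= /lebesgue_rV_succ /pushforward.
pose A : set R := `[a ord0 ord0, b ord0 ord0]%classic.
pose B : set 'rV[R]_n :=
  [set x | forall i, (a' ord0 i <= x ord0 i <= b' ord0 i)%R].
transitivity ((@lebesgue_measure R \x lebesgue_rV n) (A `*` B)).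
  apply: (congr1 (@lebesgue_measure R \x lebesgue_rV n)).
  apply/seteqP; split=> [p /= h|p /= [h1 h2] i].
    split; first by have := h ord0; rewrite rV_cons0 /A /= in_itv.
    by move=> i; rewrite cons_a' cons_b' -rV_consS.
  have [j ->|->] := unliftP ord0 i.
    by rewrite rV_consS -cons_a' -cons_b'.
  by rewrite rV_cons0; move: h1; rewrite /A /= in_itv.
have mA : measurable A by exact: measurable_itv.
have mB : measurable B.
  rewrite (_ : B = \bigcap_(i in [set: 'I_n])
      (rV_coord i @^-1` `[a' ord0 i, b' ord0 i]%classic)); last first.
    apply/seteqP; split=> [x /= h i _|x /= h i].
      by rewrite /= in_itv; exact: h.
    by have := h i I; rewrite /= in_itv.
  apply: fin_bigcap_measurable => // i _.
  rewrite -[X in measurable X]setTI; apply: measurable_rV_coord => //.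
rewrite product_measure1E//=.
have -> : lebesgue_rV n B = _ := ih _ _ ab'.
rewrite big_ord_recl /= /A lebesgue_measure_itv/= lte_fin.
rewrite EFinM; congr (_ * _)%E; last first.
  by congr EFin; apply: eq_bigr => i _; rewrite cons_a' cons_b'.
case: ltP => // ba; rewrite (_ : b ord0 ord0 = a ord0 ord0) ?subrr//.
by apply/eqP; rewrite eq_le ba ab.
Qed.

End lebesgue_rV.

Section convex_bodies.
Context {R : realType} {n : nat}.
Implicit Types (K L : set 'rV[R]_n) (x y : 'rV[R]_n).

Definition dotv x y : R := \sum_(i < n) x ord0 i * y ord0 i.

(* The library's norm on ['rV[R]_n] is the sup norm. *)
Definition enorm x : R := Num.sqrt (dotv x x).

Definition convex_body K : Prop :=
  [/\ compact K, convex_set K & K° !=set0].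

Definition support_fun K y : R := sup [set dotv x y | x in K].

Definition reflect_coord (i : 'I_n) x : 'rV[R]_n :=
  \row_j (if j == i then - x ord0 j else x ord0 j).

Definition unconditional K : Prop :=
  forall i y, support_fun K (reflect_coord i y) = support_fun K y.

(* At x = 0 the integrand is [0 `^ (q - n) = 0] rather than +oo when q < n, which
   does not affect the integral. *)
Definition dual_quermass (q : R) K : R :=
  q / n%:R * \int[lebesgue_rV n]_(x in K) (enorm x `^ (q - n%:R)).

(* (1 - l) . K +_0 l . L *)
Definition L0_sum (l : R) K L : set 'rV[R]_n :=
  [set x | forall y, enorm y = 1 ->
    dotv x y <= support_fun K y `^ (1 - l) * support_fun L y `^ l].

Definition dilates K L : Prop :=
  exists2 c : R, 0 < c & L = [set c *: x | x in K].

End convex_bodies.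

(* Main.v *)
Require Import Defs.
From mathcomp Require Import all_boot all_order all_algebra.
From mathcomp Require Import all_classical all_reals all_analysis.
From mathcomp Require Import measurable_realfun ring lra.
Set Implicit Arguments.
Unset Strict Implicit.
Unset Printing Implicit Defensive.
Import Order.TTheory GRing.Theory Num.Theory.
Import numFieldNormedType.Exports.
Local Open Scope classical_set_scope.
Local Open Scope ring_scope.

(* In the coordinates x = (r, r u), with r real and u in R^m, n = m + 1, the
   q-th dual quermassintegral of a body K symmetric about the hyperplane r = 0
   becomes (2 / n) \int F_K, where
     F_K(u) = (1 + |u|^2)^((q - n) / 2) * rho_K(1, u)^q
   and rho_K is the radial function.  If K and L are unconditional, the
   coordinatewise geometric mean of x in K and y in L (both in the positive
   orthant) lies in the L_0-sum M by Hoelder's inequality; Hoelder's inequality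
   for 1 + |u|^2, together with q < n, then gives
     F_M(u^(1-l) v^l) >= F_K(u)^(1-l) F_L(v)^l   for all u, v > 0,
   strictly when u <> v.  The multiplicative Prekopa-Leindler inequality yields
   the result, and because of the strictness equality forces its transport map
   to be the identity, so that F_K and F_L, hence rho_K and rho_L, are
   proportional. *)

(** * Weighted geometric means *)

(** On the whole orthant Hölder's inequality for |x| is an equality at every pair of proportional
    points, so no strictness is available there. Integrating along rays removes that direction: (1,
    u) and (1, v) share the coordinate 1, so equality in Hölder's inequality forces u = v and not
    mere proportionality.

    Two things must survive the induction on dimension. The first is regularity: positive continuous
    functions, even in each coordinate and bounded by a product of one-variable decays of exponent
    [tau > 1], form a class closed under sections and with continuous marginals, so identities are
    obtained at every point and not only almost everywhere. The second is strictness: fibres over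
    distinct first coordinates contain only distinct pairs of points, so strictness off the diagonal
    becomes strictness everywhere on such a pair of fibres; this must be turned into a strict
    inequality between marginals, and it forces the one-dimensional transport of the marginals to be
    the identity. *)

Lemma le_powRl {R : realType} (p x y : R) :
  0 <= p -> 0 <= x -> x <= y -> x `^ p <= y `^ p.
Proof.
by move=> p0 x0 xy; apply: ge0_ler_powR; rewrite ?nnegrE// (le_trans x0).
Qed.

Lemma lt_powRl {R : realType} (p x y : R) :
  0 < p -> 0 <= x -> x < y -> x `^ p < y `^ p.
Proof.
move=> p0 x0 xy; apply: gt0_ltr_powR; rewrite ?nnegrE//.
by rewrite ltW// (le_lt_trans x0).
Qed.

Section geometric_mean.
Context {R : realType}.
Variable l : R.
Hypotheses (l_gt0 : 0 < l) (l_lt1 : l < 1).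

Definition gm (a b : R) : R := a `^ (1 - l) * b `^ l.

Let l'_gt0 : 0 < 1 - l. Proof. by rewrite subr_gt0. Qed.

Lemma gm_ge0 a b : 0 <= gm a b.
Proof. by rewrite mulr_ge0// powR_ge0. Qed.

Lemma gm_gt0 a b : 0 < a -> 0 < b -> 0 < gm a b.
Proof. by move=> a0 b0; rewrite mulr_gt0// powR_gt0. Qed.

Lemma gm0l b : gm 0 b = 0.
Proof. by rewrite /gm powR0 ?mul0r// gt_eqF. Qed.

Lemma gm0r a : gm a 0 = 0.
Proof. by rewrite /gm powR0 ?mulr0// gt_eqF. Qed.

Lemma gmxx a : 0 <= a -> gm a a = a.
Proof.
rewrite le_eqVlt => /predU1P[<-|a0]; first by rewrite gm0l.
by rewrite /gm -powRD ?subrK ?powRr1// ?ltW// gt_eqF// implybT.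
Qed.

Lemma gmM a b c d : 0 <= a -> 0 <= b -> 0 <= c -> 0 <= d ->
  gm (a * c) (b * d) = gm a b * gm c d.
Proof. by move=> *; rewrite /gm !powRM// mulrACA. Qed.

Lemma gmZ c a b : 0 <= c -> 0 <= a -> 0 <= b ->
  gm (c * a) (c * b) = c * gm a b.
Proof. by move=> *; rewrite gmM// gmxx. Qed.

Lemma gmMr a b c : 0 <= b -> 0 <= c -> gm a (b * c) = gm a b * c `^ l.
Proof. by move=> b0 c0; rewrite /gm powRM// mulrA. Qed.

Lemma gm_mulr a c : 0 <= a -> 0 <= c -> gm a (c * a) = c `^ l * a.
Proof. by move=> a0 c0; rewrite mulrC gmMr// gmxx// mulrC. Qed.

Lemma gm_powR a b p : gm (a `^ p) (b `^ p) = gm a b `^ p.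
Proof.
rewrite /gm (powRM p (powR_ge0 a (1 - l)) (powR_ge0 b l)) -!powRrM.
by rewrite (mulrC p) (mulrC p).
Qed.

Lemma gm_le a b c d : 0 <= a -> 0 <= b -> a <= c -> b <= d ->
  gm a b <= gm c d.
Proof.
move=> a0 b0 ac bd; apply: ler_pM; rewrite ?powR_ge0//.
  exact: le_powRl (ltW l'_gt0) a0 ac.
exact: le_powRl (ltW l_gt0) b0 bd.
Qed.

Lemma gm_expR a b : 0 < a -> 0 < b ->
  gm a b = expR ((1 - l) * ln a + l * ln b).
Proof. by move=> a0 b0; rewrite /gm /powR !gt_eqF// -expRD. Qed.

(** Dividing by [G = gm a b] leaves logarithms [x], [y] with weighted mean 0, so the bound 1 + t <=
    exp t, strict at [x], sums to the claim. *)
Lemma am_gm_lt a b : 0 < a -> 0 < b -> a != b ->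
  gm a b < (1 - l) * a + l * b.
Proof.
move=> a0 b0 ab; set G := gm a b.
have G0 : 0 < G by exact: gm_gt0.
pose x := ln (a / G); pose y := ln (b / G).
have xE : a = G * expR x by rewrite lnK ?posrE ?divr_gt0// mulrC divfK ?gt_eqF.
have yE : b = G * expR y by rewrite lnK ?posrE ?divr_gt0// mulrC divfK ?gt_eqF.
have xy0 : (1 - l) * x + l * y = 0.
  rewrite /x /y !lnM ?posrE ?invr_gt0// !lnV ?posrE//.
  have -> : ln G = (1 - l) * ln a + l * ln b by rewrite /G gm_expR// expRK.
  ring.
have x0 : x != 0.
  apply: contra ab => /eqP x0; rewrite xE yE x0.
  have -> // : y = 0.
  by move/eqP: xy0; rewrite x0 mulr0 add0r mulf_eq0 gt_eqF//= => /eqP.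
have ex : 1 + x < expR x by exact: expR_gt1Dx.
have ey : 1 + y <= expR y by exact: expR_ge1Dx.
rewrite {1}xE {1}yE.
have -> : (1 - l) * (G * expR x) + l * (G * expR y) =
    G * ((1 - l) * expR x + l * expR y) by ring.
rewrite ltr_pMr//.
apply: (@le_lt_trans _ _ ((1 - l) * (1 + x) + l * (1 + y))).
  by rewrite !mulrDr addrACA xy0 addr0 !mulr1 subrK.
apply: ltr_leD; first by rewrite ltr_pM2l.
by rewrite ler_pM2l.
Qed.

Lemma am_gm a b : 0 <= a -> 0 <= b -> gm a b <= (1 - l) * a + l * b.
Proof.
rewrite le_eqVlt => /predU1P[<-|a0].
  by move=> b0; rewrite gm0l mulr0 add0r mulr_ge0// ltW.
rewrite le_eqVlt => /predU1P[<-|b0].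
  by rewrite gm0r mulr0 addr0 mulr_ge0// ltW.
have [->|ab] := eqVneq a b; first by rewrite (gmxx (ltW b0)) -mulrDl subrK mul1r.
by rewrite ltW// am_gm_lt.
Qed.

(** Hölder's inequality with exponents 1 / (1 - l) and 1 / l: once both families are normalised to
    total 1, it is the weighted AM-GM inequality summed termwise. Zero totals are treated apart, as
    they cannot be normalised. *)
Lemma sum_gm_le (I : finType) (a b : I -> R) :
  (forall i, 0 <= a i) -> (forall i, 0 <= b i) ->
  \sum_i gm (a i) (b i) <= gm (\sum_i a i) (\sum_i b i).
Proof.
move=> a0 b0; set A := \sum_i a i; set B := \sum_i b i.
have A0 : 0 <= A by exact: sumr_ge0.
have B0 : 0 <= B by exact: sumr_ge0.
move: (A0); rewrite le_eqVlt => /predU1P[A00|Agt].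
  rewrite big1 ?gm_ge0// => i _.
  have -> : a i = 0 by move/esym/psumr_eq0P: A00 => ->.
  by rewrite gm0l.
move: (B0); rewrite le_eqVlt => /predU1P[B00|Bgt].
  rewrite big1 ?gm_ge0// => i _.
  have -> : b i = 0 by move/esym/psumr_eq0P: B00 => ->.
  by rewrite gm0r.
have E i : gm (a i) (b i) = gm A B * gm (a i / A) (b i / B).
  rewrite -gmM ?divr_ge0//; congr gm; rewrite mulrC divfK ?gt_eqF//.
under eq_bigr do rewrite E.
rewrite -mulr_sumr ler_piMr ?gm_ge0//.
apply: (@le_trans _ _ (\sum_i ((1 - l) * (a i / A) + l * (b i / B)))).
  by apply: ler_sum => i _; rewrite am_gm// divr_ge0.
rewrite big_split/= -!mulr_sumr -!mulr_suml !divff ?gt_eqF// !mulr1 subrK//.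
Qed.

(** Equality in Hölder's inequality occurs for proportional families; the shared entry at [i0] fixes
    the ratio at 1, so one differing entry suffices for strictness. *)
Lemma sum_gm_lt (I : finType) (a b : I -> R) i0 :
  (forall i, 0 < a i) -> (forall i, 0 < b i) -> a i0 = b i0 ->
  (exists i, a i != b i) ->
  \sum_i gm (a i) (b i) < gm (\sum_i a i) (\sum_i b i).
Proof.
move=> a0 b0 ab0 abN; set A := \sum_i a i; set B := \sum_i b i.
have A0 : 0 < A.
  by rewrite /A (bigD1 i0)//= ltr_pwDl// sumr_ge0// => *; rewrite ltW.
have B0 : 0 < B.
  by rewrite /B (bigD1 i0)//= ltr_pwDl// sumr_ge0// => *; rewrite ltW.
have E i : gm (a i) (b i) = gm A B * gm (a i / A) (b i / B).
  rewrite -gmM ?divr_ge0 ?ltW//; congr gm; rewrite mulrC divfK ?gt_eqF//.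
under eq_bigr do rewrite E.
rewrite -mulr_sumr gtr_pMr ?gm_gt0//.
have [j jN] : exists j, a j / A != b j / B.
  apply: contrapT => /forallNP H.
  have H' i : a i / A = b i / B by apply/eqP; apply: contrapT => /negP; exact: H.
  have AB : A = B.
    have := H' i0; rewrite ab0 => /(mulfI _); rewrite gt_eqF// => /(_ isT).
    exact: invr_inj.
  case: abN => i /eqP; apply; have := H' i; rewrite AB => /(mulIf _); apply.
  by rewrite invr_eq0 gt_eqF.
apply: (@lt_le_trans _ _ (\sum_i ((1 - l) * (a i / A) + l * (b i / B)))).
  rewrite (bigD1 j)//= [ltRHS](bigD1 j)//= ltr_leD// ?am_gm_lt ?divr_gt0//.
  by apply: ler_sum => i _; rewrite am_gm// divr_ge0// ltW.
rewrite big_split/= -!mulr_sumr -!mulr_suml !divff ?gt_eqF// !mulr1 subrK//.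
Qed.

End geometric_mean.

(** * One-dimensional Prekopa-Leindler inequality *)

Lemma derive_nneg_nondecreasing {R : realType} (f f' : R -> R) (x y : R) :
  (forall t : R, 0 < t -> is_derive t 1 f (f' t)) -> (forall t : R, 0 < t -> 0 <= f' t) ->
  0 < x -> x <= y -> f x <= f y.
Proof.
move=> df f'0 x0 xy.
have pos t : x <= t -> 0 < t by exact: lt_le_trans.
apply: (@ger0_derive1_le_cc R f x y); rewrite ?in_itv/= ?lexx ?xy//.
- move=> t; rewrite in_itv/= => /andP[/ltW/pos/df dt _].
  exact: ex_derive.
- move=> t; rewrite in_itv/= => /andP[/ltW/pos t0 _].
  by rewrite derive1E; have [_ ->] := df _ t0; exact: f'0.
- apply: derivable_within_continuous => t.
  by rewrite in_itv/= => /andP[/pos/df dt _]; exact: ex_derive.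
Qed.

Section primitive.
Context {R : realType}.
Notation mu := (@lebesgue_measure R).
Variable f : R -> R.
Hypotheses (cf : continuous f) (f_gt0 : forall x, 0 < f x)
  (intf : mu.-integrable `[0, +oo[ (EFin \o f)).

Definition prim (g : R -> R) (x : R) : R := \int[mu]_(t in `[0, x]) g t.
Definition halfint (g : R -> R) : R := \int[mu]_(t in `[0, +oo[) g t.

Let mf (D : set R) : measurable_fun D f.
Proof. by apply: measurable_funTS; exact: continuous_measurable_fun. Qed.

Let mEf (D : set R) : measurable_fun D (fun x => (f x)%:E).
Proof. exact/measurable_EFinP. Qed.

Let int_itv x : mu.-integrable `[0, x] (EFin \o f).
Proof. by apply: integrableS intf => //; exact: subset_itvl. Qed.

Let fin_itv x : (\int[mu]_(t in `[0%R, x]) (f t)%:E \is a fin_num)%E.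
Proof. exact: integrable_fin_num. Qed.

Let fin_itvy : (\int[mu]_(t in `[0%R, +oo[) (f t)%:E \is a fin_num)%E.
Proof. exact: integrable_fin_num. Qed.

Lemma is_derive_prim (x : R) : 0 < x -> is_derive x 1 (prim f) (f x).
Proof.
move=> x0; have cfx : {for x, continuous f} by exact: cf.
have xx1 : x < x + 1 by rewrite ltrDl.
have [d d'] := continuous_FTC1_closed xx1 (int_itv _) x0 cfx.
by split; [exact: d|rewrite -derive1E].
Qed.

Lemma prim_ge0 (x : R) : 0 <= prim f x.
Proof. by apply: Rintegral_ge0 => t _; exact: ltW. Qed.

Lemma prim0 : prim f 0 = 0.
Proof. by rewrite /prim set_itv1 Rintegral_set1. Qed.

Lemma prim_le_halfint (x : R) : prim f x <= halfint f.
Proof.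
apply: fine_le => //.
apply: ge0_subset_integral => //; [exact: mEf| |exact: subset_itvl].
by move=> t _; rewrite lee_fin ltW.
Qed.

Lemma prim_nondecreasing (x y : R) : x <= y -> prim f x <= prim f y.
Proof.
move=> xy; apply: fine_le => //.
apply: ge0_subset_integral => //; first exact: mEf.
  by move=> t _; rewrite lee_fin ltW.
by apply: subset_itvl; rewrite bnd_simp.
Qed.

Lemma prim_increasing (x y : R) : 0 < x -> x < y -> prim f x < prim f y.
Proof.
move=> x0 xy; have pos t : x <= t -> 0 < t by exact: lt_le_trans.
apply: (@gtr0_derive1_lt_cc R (prim f) x y);
  rewrite ?in_itv/= ?lexx ?(ltW xy)//.
- move=> t; rewrite in_itv/= => /andP[/ltW/pos/is_derive_prim dt _].
  exact: ex_derive.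
- move=> t; rewrite in_itv/= => /andP[/ltW/pos t0 _].
  by rewrite derive1E; have [_ ->] := is_derive_prim t0.
- apply: derivable_within_continuous => t.
  by rewrite in_itv/= => /andP[/pos/is_derive_prim dt _]; exact: ex_derive.
Qed.

Lemma prim_lt_halfint (x : R) : 0 < x -> prim f x < halfint f.
Proof.
move=> x0; apply: (@lt_le_trans _ _ (prim f (x + 1))); last exact: prim_le_halfint.
by apply: prim_increasing => //; rewrite ltrDl.
Qed.

(** Monotone convergence along the intervals [[0, k]]. Upper bounds on total mass are obtained from
    bounds on [prim] through this lemma. *)
Lemma halfint_le (C : R) : (forall x, 0 < x -> prim f x <= C) -> halfint f <= C.
Proof.
move=> PC.
have E : \bigcup_k [set` `[0, k%:R]] = `[0, +oo[%classic :> set R.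
  apply/seteqP; split=> [x [k _]/=|x/=].
    by rewrite !in_itv/= andbT => /andP[].
  rewrite in_itv/= andbT => x0; exists (Num.truncn x).+1 => //=.
  by rewrite in_itv/= x0 ltW// truncnS_gt.
have H : (\int[mu]_(x in `[0%R, k%:R]) (f x)%:E)%E @[k --> \oo] -->
    (\int[mu]_(x in `[0%R, +oo[) (f x)%:E)%E.
  rewrite -E; apply: ge0_nondecreasing_set_cvg_integral => //.
  - by move=> i j ij; apply/subsetPset; apply: subset_itvl; rewrite bnd_simp ler_nat.
  - by move=> i; exact: mEf.
  - by move=> i x _; rewrite lee_fin ltW.
rewrite -lee_fin /halfint /Rintegral fineK//.
rewrite -(cvg_lim _ H)//; apply: lime_le; first by apply/cvg_ex; eexists; exact: H.
near=> k; rewrite -[leLHS]fineK// lee_fin.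
by apply: PC; rewrite ltr0n; near: k; exact: nbhs_infty_gt.
Unshelve. all: by end_near. Qed.

Lemma halfint_gt0 : 0 < halfint f.
Proof. by rewrite (le_lt_trans (prim_ge0 1))// prim_lt_halfint. Qed.

Lemma prim_surj (p : R) : 0 < p -> p < halfint f -> exists2 x, 0 < x & prim f x = p.
Proof.
move=> p0 pI.
have [b b0 pb] : exists2 b, 0 < b & p < prim f b.
  apply: contrapT => H; have : halfint f <= p; last by rewrite leNgt pI.
  apply: halfint_le => x x0; rewrite leNgt; apply/negP => ?; apply: H.
  by exists x.
have [] := @IVT R (prim f) 0 b p (ltW b0).
- by apply: parameterized_integral_continuous; rewrite ?ltW.
- rewrite prim0 (min_idPl (prim_ge0 _)) (max_idPr (prim_ge0 _)).
  by rewrite (ltW p0) (ltW pb).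
- move=> x; rewrite in_itv/= => /andP[x0 _] xp; exists x => //.
  rewrite lt_neqAle x0 andbT; apply: contraTneq p0 => x00.
  by rewrite -xp -x00 prim0 ltxx.
Qed.

Definition prim_inv (p : R) : R := xget 1 [set x | 0 < x /\ prim f x = p].

Lemma prim_invP (p : R) : 0 < p -> p < halfint f ->
  0 < prim_inv p /\ prim f (prim_inv p) = p.
Proof.
move=> p0 /(prim_surj p0)[x x0 xp]; rewrite /prim_inv.
by case: xgetP => [y ->//|/(_ x)[]].
Qed.

Lemma primK (x : R) : 0 < x -> prim_inv (prim f x) = x.
Proof.
move=> x0; have [y0 yE] : 0 < prim_inv (prim f x) /\
    prim f (prim_inv (prim f x)) = prim f x.
  apply: prim_invP; last exact: prim_lt_halfint.
  rewrite (le_lt_trans (prim_ge0 (x / 2)))// prim_increasing ?divr_gt0//.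
  lra.
apply/eqP; rewrite eq_le !leNgt; apply/andP; split; apply/negP => h.
  by have := prim_increasing x0 h; rewrite yE ltxx.
by have := prim_increasing y0 h; rewrite yE ltxx.
Qed.

Lemma prim_gt0 (x : R) : 0 < x -> 0 < prim f x.
Proof.
move=> x0; rewrite (le_lt_trans (prim_ge0 (x / 2)))// prim_increasing ?divr_gt0//.
lra.
Qed.

Lemma is_derive_prim_inv (p : R) : 0 < p -> p < halfint f ->
  is_derive p 1 prim_inv (f (prim_inv p))^-1.
Proof.
move=> p0 pI; have [x0 xp] := prim_invP p0 pI.
rewrite -{1}xp; apply: (@is_derive_inverse R (prim f)).
- near=> y; apply: primK; near: y; exact: lt_nbhsr.
- near=> y; apply: differentiable_continuous; apply/derivable1_diffP.
  have y0 : 0 < y by near: y; exact: lt_nbhsr.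
  by have [] := is_derive_prim y0.
- exact: is_derive_prim.
- by rewrite gt_eqF.
Unshelve. all: by end_near. Qed.

End primitive.

Section prekopa_leindler_line.
Context {R : realType}.
Notation mu := (@lebesgue_measure R).
Variable l : R.
Hypotheses (l_gt0 : 0 < l) (l_lt1 : l < 1).
Variables f g h : R -> R.
Hypotheses (cf : continuous f) (f_gt0 : forall x, 0 < f x)
  (intf : mu.-integrable `[0, +oo[ (EFin \o f)).
Hypotheses (cg : continuous g) (g_gt0 : forall x, 0 < g x)
  (intg : mu.-integrable `[0, +oo[ (EFin \o g)).
Hypotheses (ch : continuous h) (h_gt0 : forall x, 0 < h x)
  (inth : mu.-integrable `[0, +oo[ (EFin \o h)).
Hypothesis fgh : forall x y : R, 0 < x -> 0 < y ->
  gm l (f x) (g y) <= h (gm l x y).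

Let If0 : 0 < halfint f. Proof. exact: halfint_gt0. Qed.

Let Ig0 : 0 < halfint g. Proof. exact: halfint_gt0. Qed.

Let c : R := halfint g / halfint f.
Let c_gt0 : 0 < c. Proof. exact: divr_gt0. Qed.
(** The monotone transport map from the density [f] to the density [g] on the half-line; [c]
    rescales the mass of [f] to that of [g]. *)
Let T (x : R) : R := prim_inv g (c * prim f x).

Let c_prim (x : R) : 0 < x -> 0 < c * prim f x < halfint g.
Proof.
move=> x0; rewrite mulr_gt0 ?prim_gt0//= /c mulrAC ltr_pdivrMr//.
by rewrite ltr_pM2l// prim_lt_halfint.
Qed.

Let T_gt0 (x : R) : 0 < x -> 0 < T x.
Proof. by move=> /c_prim/andP[p0 p1]; have [] := prim_invP cg g_gt0 intg p0 p1. Qed.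

Let prim_T (x : R) : 0 < x -> prim g (T x) = c * prim f x.
Proof. by move=> /c_prim/andP[p0 p1]; have [] := prim_invP cg g_gt0 intg p0 p1. Qed.

Let T' (x : R) : R := c * f x / g (T x).

Let T'_gt0 (x : R) : 0 < T' x.
Proof. by rewrite divr_gt0// mulr_gt0. Qed.

Let derive_T (x : R) : 0 < x -> is_derive x 1 T (T' x).
Proof.
move=> x0; have /andP[p0 p1] := c_prim x0.
have d1 : is_derive x 1 (fun x => c * prim f x) (c * f x).
  have dp := is_derive_prim cf intf x0.
  exact: is_deriveZ.
have d2 := is_derive_prim_inv cg g_gt0 intg p0 p1.
have := @is_derive1_comp _ (prim_inv g) (fun x => c * prim f x) _ _ _ d2 d1.
by rewrite /T' mulrC.
Qed.

Let Z (x : R) : R := gm l x (T x).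
Let Z' (x : R) : R := Z x * ((1 - l) * x^-1 + l * (T' x / T x)).

Let Z_gt0 (x : R) : 0 < x -> 0 < Z x.
Proof. by move=> x0; apply: gm_gt0 => //; exact: T_gt0. Qed.

Let derive_Z (x : R) : 0 < x -> is_derive x 1 Z (Z' x).
Proof.
move=> x0.
have d1 := is_derive1_ln x0.
have d2 := @is_derive1_comp _ (@ln R) T _ _ _ (is_derive1_ln (T_gt0 x0)) (derive_T x0).
have d3 : is_derive x 1 (fun x => (1 - l) * ln x + l * ln (T x))
    ((1 - l) * x^-1 + l * (T' x / T x)).
  have dA : is_derive x 1 (fun x => (1 - l) * ln x) ((1 - l) * x^-1).
    exact: is_deriveZ.
  have dB : is_derive x 1 (fun x => l * ln (T x)) (l * (T' x / T x)).
    by rewrite [T' x / _]mulrC; exact: is_deriveZ.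
  exact: is_deriveD.
have d4 := @is_derive1_comp _ expR
  (fun x => (1 - l) * ln x + l * ln (T x)) _ _ _ (is_derive_expR _) d3.
have E : \near x, expR ((1 - l) * ln x + l * ln (T x)) = Z x.
  near=> y; have y0 : 0 < y by near: y; exact: lt_nbhsr.
  by rewrite /Z gm_expR//; exact: T_gt0.
apply: (near_eq_is_derive E).
by move: d4; rewrite /Z' /Z gm_expR//; exact: T_gt0.
Unshelve. all: by end_near. Qed.

Let S (x : R) : R := prim h (Z x).
Let k : R := c `^ l.
(** The excess of the mass of [h] on [[0, Z x]] over its target. The factor [k] is chosen so that
    [k * halfint f] is the geometric mean of the two masses ([gm_halfint]); the inequality then
    rests on the monotonicity of [D]. *)
Let D (x : R) : R := S x - k * prim f x.
Let D' (x : R) : R := h (Z x) * Z' x - k * f x.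

Let derive_D (x : R) : 0 < x -> is_derive x 1 D (D' x).
Proof.
move=> x0; have d1 := is_derive_prim ch inth (Z_gt0 x0).
have d2 := @is_derive1_comp _ (prim h) Z _ _ _ d1 (derive_Z x0).
have dp := is_derive_prim cf intf x0.
have dB : is_derive x 1 (fun x => k * prim f x) (k * f x).
  exact: is_deriveZ.
exact: is_deriveB.
Qed.

(** The transport equation c f(x) = g(T x) T'(x) is inserted into c^l f = gm(f, c f). *)
Let k_f (x : R) : k * f x = gm l (f x) (g (T x)) * T' x `^ l.
Proof.
have E : c * f x = g (T x) * T' x by rewrite /T' [RHS]mulrC divfK// gt_eqF.
rewrite -(gm_mulr l_lt1 (ltW (f_gt0 x)) (ltW c_gt0)) E.
exact: gmMr (ltW (g_gt0 _)) (ltW (T'_gt0 _)).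
Qed.

(** AM-GM for the logarithmic derivatives 1 / x and T' / T, multiplied by [Z x], the geometric mean
    of [x] and [T x]. *)
Let T'_Z' (x : R) : 0 < x -> T' x `^ l <= Z' x.
Proof.
move=> x0; have T0 := T_gt0 x0; have T'0 := T'_gt0 x.
apply: (@le_trans _ _ (Z x * gm l x^-1 (T' x / T x))).
  have -> : Z x * gm l x^-1 (T' x / T x) = gm l 1 (T' x).
    have T'T : 0 <= T' x / T x by rewrite divr_ge0// ltW.
    have xV : 0 <= x^-1 by rewrite invr_ge0 ltW.
    rewrite /Z -(gmM l (ltW x0) (ltW T0) xV T'T) mulfV ?gt_eqF//.
    by rewrite [T x * _]mulrC divfK// gt_eqF.
  by rewrite /gm powR1 mul1r.
rewrite /Z' ler_pM2l ?Z_gt0//; apply: am_gm => //.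
  by rewrite invr_ge0 ltW.
by rewrite divr_ge0// ltW.
Qed.

Let D'_ge0 (x : R) : 0 < x -> 0 <= D' x.
Proof.
move=> x0; rewrite subr_ge0 k_f; apply: ler_pM.
- exact: gm_ge0.
- exact: powR_ge0.
- by apply: fgh => //; exact: T_gt0.
- exact: T'_Z'.
Qed.

Let D_nondecreasing (x y : R) : 0 < x -> x <= y -> D x <= D y.
Proof. exact: derive_nneg_nondecreasing derive_D D'_ge0. Qed.

Let k_gt0 : 0 < k. Proof. exact: powR_gt0. Qed.

(** If [D x < 0], a point [y] below [x] is chosen with so little mass [p] before it that
    [k * p < - D x]; since [S y >= 0], this gives [D y > D x], against monotonicity. The argument
    thus avoids a limit of [Z] at 0. *)
Let D_ge0 (x : R) : 0 < x -> 0 <= D x.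
Proof.
move=> x0; rewrite leNgt; apply/negP => Dx.
pose p := Num.min (prim f x) (- D x / k) / 2.
have m0 : 0 < Num.min (prim f x) (- D x / k).
  by rewrite lt_min prim_gt0//= divr_gt0// oppr_gt0.
have p0 : 0 < p by rewrite divr_gt0.
have pm : p < Num.min (prim f x) (- D x / k).
  by rewrite /p ltr_pdivrMr// ltr_pMr// ltr1n.
have [px pD] : p < prim f x /\ p < - D x / k.
  by move: pm; rewrite lt_min => /andP.
have [y y0 yp] := prim_surj cf f_gt0 intf p0
  (lt_trans px (prim_lt_halfint cf f_gt0 intf x0)).
have yx : y <= x.
  rewrite leNgt; apply/negP => xy.
  by have := prim_increasing cf f_gt0 intf x0 xy; rewrite yp ltNge (ltW px).
have H : S y - k * p <= D x by rewrite -yp; exact: D_nondecreasing.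
have S0 : 0 <= S y by exact: prim_ge0.
move: pD; rewrite ltr_pdivlMr// mulrC ltrNr => pD.
by have := le_lt_trans H pD; rewrite ltrBlDr addNr ltNge S0.
Qed.

Let gm_halfint : k * halfint f = gm l (halfint f) (halfint g).
Proof.
have -> : halfint g = c * halfint f by rewrite divfK// gt_eqF.
by rewrite (gm_mulr l_lt1 (ltW If0) (ltW c_gt0)).
Qed.

Let halfint_le_bound (C : R) : (forall x, 0 < x -> k * prim f x <= C) ->
  k * halfint f <= C.
Proof.
move=> H; rewrite mulrC -ler_pdivlMr//; apply: (halfint_le cf f_gt0 intf) => x x0.
by rewrite ler_pdivlMr// mulrC H.
Qed.

Lemma pl_line : gm l (halfint f) (halfint g) <= halfint h.
Proof.
rewrite -gm_halfint; apply: halfint_le_bound => x x0.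
have := D_ge0 x0; rewrite subr_ge0 => /le_trans; apply.
exact: prim_le_halfint.
Qed.

(** Equality squeezes [D]: it is nonnegative, nondecreasing and at most [halfint h - k * prim f],
    which tends to 0. So [D] and its derivative vanish, and neither of the two inequalities
    multiplied in [D'_ge0] can be strict; the witness is [T x]. *)
Lemma pl_line_eq : halfint h = gm l (halfint f) (halfint g) ->
  forall x : R, 0 < x -> exists y : R,
    [/\ 0 < y, prim g y = halfint g / halfint f * prim f x &
      h (gm l x y) = gm l (f x) (g y)].
Proof.
rewrite -gm_halfint => Ih.
have D0 (x : R) : 0 < x -> D x = 0.
  move=> x0; apply/eqP; rewrite eq_le D_ge0// andbT.
  suff : k * halfint f <= halfint h - D x by rewrite Ih lerBrDr gerDl.
  apply: halfint_le_bound => y y0.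
  (* At the larger point both monotonicities apply: that of [D] from [x] and that of [prim f] from
     [y]. *)
  pose z := Num.max x y.
  have z0 : 0 < z by rewrite lt_max x0.
  have xz : x <= z by rewrite le_max lexx.
  have yz : y <= z by rewrite le_max lexx orbT.
  apply: (@le_trans _ _ (k * prim f z)).
    by rewrite ler_pM2l// prim_nondecreasing.
  rewrite lerBrDl -lerBrDr; apply: (le_trans (D_nondecreasing x0 xz)).
  by rewrite lerD2r; exact: prim_le_halfint.
move=> x x0; exists (T x); split; [exact: T_gt0|exact: prim_T|].
have D'0 : D' x = 0.
  have dD := derive_D x0.
  have E : \near x, cst (0 : R) x = D x.
    by near=> y; rewrite /= D0//; near: y; exact: lt_nbhsr.
  have [_ D0'] : is_derive x 1 D 0.
    exact: near_eq_is_derive E (is_derive_cst (0 : R) x 1).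
  by have [_ <-] := dD.
have H1 : gm l (f x) (g (T x)) <= h (Z x) by apply: fgh => //; exact: T_gt0.
apply/eqP; rewrite eq_le H1 andbT leNgt; apply/negP => H2.
move/eqP: D'0; rewrite subr_eq0 k_f gt_eqF//.
apply: (@lt_le_trans _ _ (h (Z x) * T' x `^ l)).
  by rewrite ltr_pM2r// powR_gt0.
by rewrite ler_pM2l// T'_Z'.
Unshelve. all: by end_near. Qed.

End prekopa_leindler_line.

(** * Topology, measurability and Fubini on R^n *)

Section row_topology.
Context {R : realType}.

Lemma row_norm_lt n (x : 'rV[R]_n) (e : R) :
  `|x| < e <-> 0 < e /\ forall i, `|x ord0 i| < e.
Proof.
rewrite {1}/Num.norm/= mx_normrE; split.
  move=> /bigmax_ltP[e0 h]; split => // i.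
  by have := h (ord0, i) isT.
by move=> [e0 h]; apply/bigmax_ltP; split => // -[i j] _; rewrite (ord1 i).
Qed.

Lemma row_coord_le n (x : 'rV[R]_n) i : `|x ord0 i| <= `|x|.
Proof.
rewrite [leRHS]/Num.norm/= mx_normrE.
by apply/bigmax_geP; right; exists (ord0, i).
Qed.

(** This links the sigma-algebra generated by the coordinates to the topology: an open set is the
    countable union of the rational boxes it contains. *)
Lemma open_measurable_rV n (U : set 'rV[R]_n) : open U -> measurable U.
Proof.
move=> oU.
pose box (p : 'rV[rat]_n * 'rV[rat]_n) : set 'rV[R]_n :=
  [set x | forall i, ratr (p.1 ord0 i) < x ord0 i < ratr (p.2 ord0 i)].
have mbox p : measurable (box p).
  rewrite (_ : box p = \bigcap_(i in [set: 'I_n])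
      (rV_coord i @^-1` `]ratr (p.1 ord0 i), ratr (p.2 ord0 i)[%classic)); last first.
    apply/seteqP; split=> [x /= h i _|x /= h i].
      by rewrite /= in_itv; exact: h.
    by have := h i I; rewrite /= in_itv.
  apply: fin_bigcap_measurable => // i _.
  rewrite -[X in measurable X]setTI; apply: measurable_rV_coord => //.
pose F p := if `[< box p `<=` U >] then box p else set0.
rewrite (_ : U = \bigcup_p F p).
  apply: countable_bigcupT_measurable => // p; rewrite /F; case: ifPn => // _.
apply/seteqP; split => [x Ux|x [p _]]; last first.
  by rewrite /F; case: ifPn => // /asboolP; apply.
have /nbhs_ballP[e /= e0 xeU] : nbhs x U by exact: open_nbhs_nbhs.
have /choice[a aP] i : exists q : rat, x ord0 i - e < ratr q < x ord0 i.
  have : x ord0 i - e < x ord0 i by rewrite ltrBlDr ltrDl.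
  by move=> /rat_in_itvoo[q]; exists q.
have /choice[b bP] i : exists q : rat, x ord0 i < ratr q < x ord0 i + e.
  have : x ord0 i < x ord0 i + e by rewrite ltrDl.
  by move=> /rat_in_itvoo[q]; exists q.
exists (\row_i a i, \row_i b i) => //.
rewrite /F asboolT.
  move=> i /=; rewrite !mxE.
  by have /andP[_ ->] := aP i; have /andP[-> _] := bP i.
move=> y /= xy; apply: xeU; rewrite -ball_normE/=; apply/row_norm_lt; split => // i.
have := xy i; rewrite !mxE => /andP[y1 y2].
have /andP[a1 a2] := aP i; have /andP[b1 b2] := bP i.
rewrite ltr_norml; apply/andP; split; lra.
Qed.

Lemma continuous_measurable_rV n (f : 'rV[R]_n -> R) :
  continuous f -> measurable_fun [set: 'rV[R]_n] f.
Proof.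
move=> /continuousP cf; apply: (measurability _ (RGenOpens.measurableE R)).
move=> _ [_ [a [b ->] <-]]; rewrite setTI; apply: open_measurable_rV.
exact/cf/interval_open.
Qed.

Lemma continuous_rowP (T : topologicalType) n (f : T -> 'rV[R]_n) :
  (forall i, continuous (fun t => f t ord0 i)) -> continuous f.
Proof.
move=> cf t; apply/cvgrPdist_lt => e e0.
near=> s; apply/row_norm_lt; split => //; near: s; apply: filter_forall => i.
have /cvgrPdist_lt/(_ _ e0) := cf i t.
by apply: filterS => s; rewrite !mxE.
Unshelve. all: by end_near. Qed.

Lemma continuous_rV_consr n (a : R) :
  continuous (fun u : 'rV[R]_n => rV_cons (a, u)).
Proof.
apply: continuous_rowP => i.
have [j ->|->] := unliftP ord0 i.
  rewrite (_ : (fun _ => _) = (fun u : 'rV[R]_n => u ord0 j)).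
    exact: coord_continuous.
  by apply/funext => u; rewrite rV_consS.
rewrite (_ : (fun _ => _) = cst a); first exact: cst_continuous.
by apply/funext => u; rewrite rV_cons0.
Qed.

Lemma continuous_rV_consl n (u : 'rV[R]_n) :
  continuous (fun a : R => rV_cons (a, u)).
Proof.
apply: continuous_rowP => i.
have [j ->|->] := unliftP ord0 i.
  rewrite (_ : (fun _ => _) = cst (u ord0 j)); first exact: cst_continuous.
  by apply/funext => a; rewrite rV_consS.
rewrite (_ : (fun _ => _) = (fun a : R => a)); first by move=> x; exact: cvg_id.
by apply/funext => a; rewrite rV_cons0.
Qed.

Lemma reflect_rV_cons0 n (a : R) (u : 'rV[R]_n) :
  reflect_coord ord0 (rV_cons (a, u)) = rV_cons (- a, u).
Proof.
apply/rowP => i; rewrite mxE.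
by have [j ->|->] := unliftP ord0 i; rewrite ?rV_consS// !rV_cons0.
Qed.

Lemma reflect_rV_consS n j (a : R) (u : 'rV[R]_n) :
  reflect_coord (lift ord0 j) (rV_cons (a, u)) = rV_cons (a, reflect_coord j u).
Proof.
apply/rowP => i; rewrite mxE.
have [k ->|->] := unliftP ord0 i; last by rewrite !rV_cons0.
by rewrite (inj_eq lift_inj) !rV_consS mxE.
Qed.

Lemma rV_unconsK n (x : 'rV[R]_n.+1) : rV_cons (rV_uncons x) = x.
Proof.
apply/rowP => i; have [j ->|->] := unliftP ord0 i; last by rewrite rV_cons0.
by rewrite rV_consS /= mxE; congr (x _ _); exact/val_inj.
Qed.

End row_topology.

Section row_fubini.
Context {R : realType}.
Local Open Scope ereal_scope.

Lemma integral_rVS m (F : 'rV[R]_m.+1 -> \bar R) :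
  measurable_fun [set: 'rV[R]_m.+1] F -> (forall x, 0 <= F x) ->
  \int[lebesgue_rV m.+1]_x F x =
  \int[@lebesgue_measure R]_a \int[lebesgue_rV m]_u F (rV_cons (a, u)).
Proof.
move=> mF F0.
pose P : {measure set (measurableTypeR R * 'rV[R]_m)%type -> \bar R} :=
  (@lebesgue_measure R \x lebesgue_rV m)%E.
transitivity (\int[pushforward P rV_cons]_x F x) => //.
rewrite (@ge0_integral_pushforward _ _ (measurableTypeR R * 'rV[R]_m)%type _ R
  rV_cons (@measurable_rV_cons R m)
  P setT F measurableT mF (fun y _ => F0 y)).
rewrite preimage_setT fubini_tonelli1//=.
by apply: measurableT_comp => //; exact: measurable_rV_cons.
Qed.

Lemma measurable_section_integral m (F : 'rV[R]_m.+1 -> \bar R) :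
  measurable_fun [set: 'rV[R]_m.+1] F -> (forall x, 0 <= F x) ->
  measurable_fun [set: R] (fun a => \int[lebesgue_rV m]_u F (rV_cons (a, u))).
Proof.
move=> mF F0.
have mFc : measurable_fun [set: measurableTypeR R * 'rV[R]_m] (F \o rV_cons).
  by apply: measurableT_comp => //; exact: measurable_rV_cons.
have := @measurable_fun_fubini_tonelli_F _ _ (measurableTypeR R) 'rV[R]_m R
  (lebesgue_rV m) (F \o rV_cons) mFc (fun p => F0 (rV_cons p)).
exact.
Qed.

Lemma integral_rV0 (F : 'rV[R]_0 -> \bar R) :
  measurable_fun [set: 'rV[R]_0] F -> \int[lebesgue_rV 0]_x F x = F 0%R.
Proof. by move=> mF; rewrite integral_dirac// diracT mul1e. Qed.

End row_fubini.

(** * Prekopa-Leindler inequality on R^n *)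

Section powR_continuity.
Context {R : realType}.

Lemma powR_continuous_pos (p x : R) : 0 < x -> {for x, continuous (fun y : R => y `^ p)}.
Proof.
move=> x0; apply: differentiable_continuous; apply/derivable1_diffP.
by apply: derivable_powR; rewrite in_itv/= andbT.
Qed.

Lemma continuous_powRl (T : topologicalType) (f : T -> R) (p : R) :
  continuous f -> (forall x, 0 < f x) -> continuous (fun x => f x `^ p).
Proof.
move=> cf f0 x.
suff : {for x, continuous ((fun y : R => y `^ p) \o f)} by [].
apply: continuous_comp; first exact: cf.
exact: powR_continuous_pos.
Qed.

Lemma continuous_prodr (T : topologicalType) (I : Type) (r : seq I)
    (f : I -> T -> R) : (forall i, continuous (f i)) ->
  continuous (fun x => \prod_(i <- r) f i x).
Proof.
move=> cf; elim: r => [|i r IH] x.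
  rewrite (_ : (fun x => _) = cst 1); first exact: cvg_cst.
  by apply/funext => y; rewrite big_nil.
rewrite (_ : (fun x => _) = (fun x => f i x * \prod_(j <- r) f j x)).
  by apply: cvgM; [exact: cf|exact: IH].
by apply/funext => y; rewrite big_cons.
Qed.

Lemma powR_cvgy0 (s : R) : 0 < s -> (1 + x) `^ (- s) @[x --> +oo%R] --> (0 : R).
Proof.
move=> s0; apply/cvgrPdist_lt => e e0.
have e'0 : 0 < e `^ (- s^-1) by exact: powR_gt0.
near=> x; have x0 : 0 < x by near: x; exact: nbhs_pinfty_gt.
rewrite sub0r normrN ger0_norm ?powR_ge0// powRN.
have -> : e = (e `^ (- s^-1) `^ s)^-1.
  rewrite -powRrM mulNr mulVf ?gt_eqF// powRN powRr1 ?invrK//; exact: ltW.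
rewrite ltf_pV2 ?posrE ?powR_gt0//; last by rewrite addr_gt0.
apply: lt_powRl => //; first exact: ltW.
have : e `^ (- s^-1) < x by near: x; exact: nbhs_pinfty_gt.
by move=> /lt_trans; apply; rewrite ltrDr.
Unshelve. all: by end_near. Qed.

End powR_continuity.

Section domination.
Context {R : realType}.
Notation leb := (@lebesgue_measure R).

Definition decay (tau : R) (x : R) : R := (1 + `|x|) `^ (- tau).

(** A product, unlike a power of the norm, factors under [rV_cons]: sections of a dominated function
    stay dominated, and integrability reduces to dimension one. *)
Definition decay_rV (tau : R) n (u : 'rV[R]_n) : R :=
  \prod_(i < n) decay tau (u ord0 i).

Lemma decay_gt0 tau x : 0 < decay tau x.
Proof. by rewrite powR_gt0// ltr_pwDl. Qed.

Lemma continuous_decay tau : continuous (decay tau).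
Proof.
apply: continuous_powRl => x; last by rewrite ltr_pwDl.
by apply: cvgD; [exact: cvg_cst|exact: norm_continuous].
Qed.

Lemma decay_rV_gt0 tau n (u : 'rV[R]_n) : 0 < decay_rV tau u.
Proof. by apply: prodr_gt0 => i _; exact: decay_gt0. Qed.

Lemma decay_rV_cons tau n (a : R) (u : 'rV[R]_n) :
  decay_rV tau (rV_cons (a, u)) = decay tau a * decay_rV tau u.
Proof.
rewrite /decay_rV big_ord_recl rV_cons0; congr (_ * _).
by apply: eq_bigr => i _; rewrite rV_consS.
Qed.

Lemma continuous_decay_rV tau n : continuous (@decay_rV tau n).
Proof.
apply: continuous_prodr => i u.
suff : {for u, continuous (decay tau \o (fun u : 'rV[R]_n => u ord0 i))} by [].
apply: continuous_comp; first exact: coord_continuous.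
exact: continuous_decay.
Qed.

Lemma integral_decay_lty tau : 1 < tau ->
  (\int[leb]_x (decay tau x)%:E < +oo)%E.
Proof.
move=> tau1; have t0 : 0 < tau - 1 by rewrite subr_gt0.
rewrite ge0_symfun_integralT; last 3 first.
- by move=> x; exact/ltW/decay_gt0.
- exact: continuous_decay.
- by move=> x; rewrite /decay/= normrN.
rewrite -set_itvcy.
pose F (x : R) := - (tau - 1)^-1 * (1 + x) `^ (- (tau - 1)).
have dF (x : R) : 0 < x -> is_derive x 1 F (decay tau x).
  move=> x0; have y0 : 0 < 1 + x by rewrite addr_gt0.
  have d1 : is_derive x 1 (fun x : R => 1 + x) 1.
    by rewrite -[X in is_derive _ _ _ X]add0r; exact: is_deriveD.
  have d2 := @is_derive1_comp _ (fun y : R => y `^ (- (tau - 1))) (fun x => 1 + x) _ _ _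
    (is_derive1_powR _ y0) d1.
  have -> : decay tau x =
      - (tau - 1)^-1 * (- (tau - 1) * (1 + x) `^ (- (tau - 1) - 1) * 1).
    rewrite mulr1 mulrA mulrNN mulVf ?gt_eqF// mul1r /decay gtr0_norm//.
    by congr (_ `^ _); lra.
  exact: is_deriveZ.
rewrite (@ge0_continuous_FTC2y R (decay tau) F 0 0).
- by rewrite -EFinB -EFinM ltry.
- by move=> x _; exact/ltW/decay_gt0.
- by apply: continuous_subspaceT; exact: continuous_decay.
- rewrite -[X in _ --> X](mulr0 (- (tau - 1)^-1)).
  by apply: cvgM; [exact: cvg_cst|exact: powR_cvgy0].
- by move=> x x0; have [] := dF _ x0.
- apply: cvg_at_right_filter; apply: cvgM; first exact: cvg_cst.
  suff : {for 0, continuous ((fun y : R => y `^ (- (tau - 1))) \o (fun x : R => 1 + x))}.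
    by [].
  apply: continuous_comp; last by apply: powR_continuous_pos; rewrite addr0.
  by apply: cvgD; [exact: cvg_cst|exact: cvg_id].
- move=> x; rewrite in_itv/= andbT => x0; rewrite derive1E.
  by have [_ ->] := dF _ x0.
Qed.

Lemma integral_decay_rV_lty tau n : 1 < tau ->
  (\int[lebesgue_rV n]_u (decay_rV tau u)%:E < +oo)%E.
Proof.
move=> tau1; have mD k : measurable_fun [set: 'rV[R]_k] (fun u => (decay_rV tau u)%:E).
  apply/measurable_EFinP; apply: continuous_measurable_rV; exact: continuous_decay_rV.
elim: n => [|n IH]; first by rewrite integral_rV0// ltry.
rewrite integral_rVS//; last by move=> x; rewrite lee_fin ltW// decay_rV_gt0.
under eq_integral => a _.
  under eq_integral => u _ do rewrite decay_rV_cons EFinM.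
  rewrite ge0_integralZl_EFin//; last 3 first.
  - by move=> u _; rewrite lee_fin ltW// decay_rV_gt0.
  - exact: mD.
  - exact/ltW/decay_gt0.
  over.
rewrite /=; set J := (\int[_]_u _)%E in IH *.
have J0 : (0 <= J)%E.
  by apply: integral_ge0 => u _; rewrite lee_fin ltW// decay_rV_gt0.
rewrite -[J]fineK ?ge0_fin_numE//.
rewrite ge0_integralZr//=; last 3 first.
- by apply/measurable_EFinP; apply: continuous_measurable_fun; exact: continuous_decay.
- by move=> x _; rewrite lee_fin ltW// decay_gt0.
- by rewrite lee_fin fine_ge0.
have K0 : (0 <= \int[leb]_x (decay tau x)%:E)%E.
  by apply: integral_ge0 => x _; rewrite lee_fin ltW// decay_gt0.
by rewrite lte_mul_pinfty ?ltry// ge0_fin_numE// integral_decay_lty.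
Qed.

End domination.

Section good_functions.
Context {R : realType}.
Notation leb := (@lebesgue_measure R).
Variable tau : R.
Hypothesis tau_gt1 : 1 < tau.

(** The class in which the induction on dimension runs. The majorant makes sections integrable and
    marginals continuous; evenness reduces each line integral to [[0, +oo)], where geometric means
    of coordinates are taken. *)
Definition good n (F : 'rV[R]_n -> R) : Prop :=
  [/\ continuous F, forall u, 0 < F u,
      forall i u, F (reflect_coord i u) = F u &
      exists C, forall u, F u <= C * decay_rV tau u].

Definition marginal n (F : 'rV[R]_n.+1 -> R) (a : R) : R :=
  \int[lebesgue_rV n]_u F (rV_cons (a, u)).

Lemma integrable_decay_rV n :
  (lebesgue_rV n).-integrable setT (fun u => (decay_rV tau u)%:E).
Proof.
apply/integrableP; split.
  by apply/measurable_EFinP; apply: continuous_measurable_rV; exact: continuous_decay_rV.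
under eq_integral do rewrite gee0_abs ?lee_fin ?(ltW (decay_rV_gt0 _ _))//.
exact: integral_decay_rV_lty.
Qed.

Lemma integrable_dominated_rV n (F : 'rV[R]_n -> R) C :
  continuous F -> (forall u, 0 <= F u) -> (forall u, F u <= C * decay_rV tau u) ->
  (lebesgue_rV n).-integrable setT (fun u => (F u)%:E).
Proof.
move=> cF F0 FC.
apply: (le_integrable measurableT _ _
  (integrableZl measurableT C (integrable_decay_rV n))).
  by apply/measurable_EFinP; exact: continuous_measurable_rV.
move=> u _ /=; rewrite lee_fin ger0_norm//.
by rewrite (le_trans (FC u))// ler_norm.
Qed.

Lemma good_integrable n (F : 'rV[R]_n -> R) :
  good F -> (lebesgue_rV n).-integrable setT (fun u => (F u)%:E).
Proof.
by case=> cF F0 _ [C FC]; apply: integrable_dominated_rV FC => // u; exact: ltW.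
Qed.

Lemma good_section n (F : 'rV[R]_n.+1 -> R) (a : R) :
  good F -> good (fun u => F (rV_cons (a, u))).
Proof.
case=> cF F0 symF [C FC]; split => //.
- move=> u; suff : {for u, continuous (F \o (fun u => rV_cons (a, u)))} by [].
  by apply: continuous_comp; [exact: continuous_rV_consr|exact: cF].
- by move=> i u; rewrite -reflect_rV_consS symF.
- exists (C * decay tau a) => u.
  by rewrite (le_trans (FC _))// decay_rV_cons mulrA.
Qed.

Lemma decay_le1 x : decay tau x <= 1.
Proof.
rewrite /decay powRN invf_le1 ?powR_gt0 ?ltr_pwDl//.
apply: (@le_trans _ _ (1 `^ tau)); first by rewrite powR1.
by apply: le_powRl; rewrite ?lerDl// ltW// (lt_trans ltr01).
Qed.

(** Dominated convergence: as [decay tau a <= 1], the sections have the majorant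
    [C * decay_rV tau u], which does not depend on [a]. *)
Lemma marginal_continuous n (F : 'rV[R]_n.+1 -> R) :
  good F -> continuous (marginal F).
Proof.
move=> gF a; have [cF F0 symF [C FC]] := gF.
have C0 : 0 <= C.
  have := lt_le_trans (F0 0) (FC 0).
  by rewrite pmulr_lgt0 ?decay_rV_gt0// => /ltW.
have := @continuity_under_integral R _ 'rV[R]_n (lebesgue_rV n)
  (fun a u => F (rV_cons (a, u))) setT measurableT (a - 1) (a + 1) _ _
  (fun u => C * decay_rV tau u) _ _ a.
apply.
- by move=> x _; exact: good_integrable (good_section x gF).
- apply: aeW => u _ x _.
  suff : {for x, continuous (F \o (fun x => rV_cons (x, u)))} by [].
  by apply: continuous_comp; [exact: continuous_rV_consl|exact: cF].
- exact: (integrableZl measurableT C (integrable_decay_rV n)).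
- move=> x _; apply: aeW => u _; rewrite ger0_norm; last exact: ltW.
  rewrite (le_trans (FC _))// decay_rV_cons ler_wpM2l//.
  by rewrite ler_piMl ?decay_le1// ltW// decay_rV_gt0.
- by rewrite inE/= in_itv/= ltrBlDr ltrDl ltr01.
Qed.

Lemma marginal_fineK n (F : 'rV[R]_n.+1 -> R) (a : R) : good F ->
  (\int[lebesgue_rV n]_u (F (rV_cons (a, u)))%:E)%E = (marginal F a)%:E.
Proof.
move=> gF; rewrite /marginal /Rintegral fineK//; apply: integrable_fin_num => //.
exact: good_integrable (good_section a gF).
Qed.

Lemma integral_good_lty n (F : 'rV[R]_n -> R) : good F ->
  (\int[lebesgue_rV n]_u (F u)%:E)%E = (\int[lebesgue_rV n]_u F u)%:E.
Proof.
move=> gF; rewrite /Rintegral fineK//; apply: integrable_fin_num => //.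
exact: good_integrable.
Qed.

Lemma marginal_even n (F : 'rV[R]_n.+1 -> R) (a : R) : good F ->
  marginal F (- a) = marginal F a.
Proof.
case=> _ _ symF _; apply: eq_Rintegral => u _.
by rewrite -reflect_rV_cons0 symF.
Qed.

Lemma marginal_ge0 n (F : 'rV[R]_n.+1 -> R) (a : R) : good F -> 0 <= marginal F a.
Proof. by case=> _ F0 _ _; apply: Rintegral_ge0 => u _; exact: ltW. Qed.

Lemma integral_marginal n (F : 'rV[R]_n.+1 -> R) : good F ->
  (\int[lebesgue_rV n.+1]_x (F x)%:E)%E =
  (2%:E * \int[leb]_(a in `[0%R, +oo[) (marginal F a)%:E)%E.
Proof.
move=> gF; have [cF F0 _ _] := gF.
rewrite integral_rVS; last 2 first.
- by apply/measurable_EFinP; exact: continuous_measurable_rV.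
- by move=> x; rewrite lee_fin ltW.
under eq_integral do rewrite marginal_fineK//.
rewrite ge0_symfun_integralT.
- by rewrite -set_itvcy.
- by move=> a; exact: marginal_ge0.
- exact: marginal_continuous.
- by move=> a; rewrite /= marginal_even.
Qed.

Lemma marginal_integrable n (F : 'rV[R]_n.+1 -> R) : good F ->
  leb.-integrable `[0, +oo[ (EFin \o marginal F).
Proof.
move=> gF; apply/integrableP; split.
  apply/measurable_EFinP; apply: measurable_funTS.
  by apply: continuous_measurable_fun; exact: marginal_continuous.
under eq_integral do rewrite gee0_abs ?lee_fin ?marginal_ge0//.
have := integral_marginal gF; rewrite integral_good_lty//.
set J := integral _ _ _.
have J0 : (0 <= J)%E.
  by apply: integral_ge0 => a _; rewrite lee_fin marginal_ge0.
(* Twice [J] is the finite total integral, so [J] cannot be infinite. *)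
case: J J0 => [r _ _|_|//]; first exact: ltry.
by rewrite mulry gtr0_sg// mul1e.
Qed.

Lemma Rintegral_marginal n (F : 'rV[R]_n.+1 -> R) : good F ->
  \int[lebesgue_rV n.+1]_x F x = 2 * halfint (marginal F).
Proof.
move=> gF; apply: EFin_inj; rewrite -integral_good_lty// integral_marginal// EFinM.
rewrite /halfint /Rintegral fineK//; apply: integrable_fin_num => //.
exact: marginal_integrable.
Qed.

Lemma Rintegral_rV0 (F : 'rV[R]_0 -> R) : continuous F ->
  \int[lebesgue_rV 0]_x F x = F 0.
Proof.
move=> cF; rewrite /Rintegral integral_rV0//.
by apply/measurable_EFinP; exact: continuous_measurable_rV.
Qed.

Lemma Rintegral_good_gt0 n (F : 'rV[R]_n -> R) : good F ->
  0 < \int[lebesgue_rV n]_x F x.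
Proof.
elim: n F => [|n IH] F gF; first by have [cF F0 _ _] := gF; rewrite Rintegral_rV0.
rewrite Rintegral_marginal// mulr_gt0//; apply: halfint_gt0.
- exact: marginal_continuous.
- by move=> a; apply: IH; exact: good_section.
- exact: marginal_integrable.
Qed.

Lemma marginal_gt0 n (F : 'rV[R]_n.+1 -> R) (a : R) : good F -> 0 < marginal F a.
Proof. by move=> gF; exact: Rintegral_good_gt0 (good_section a gF). Qed.

End good_functions.

Section prekopa_leindler_rV.
Context {R : realType}.
Variables l tau : R.
Hypotheses (l_gt0 : 0 < l) (l_lt1 : l < 1) (tau_gt1 : 1 < tau).
Notation "'I' F" := (\int[lebesgue_rV _]_u F u) (at level 10, F at level 8).

Definition pos_rV n (u : 'rV[R]_n) : Prop := forall i, 0 < u ord0 i.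

Definition gm_rV n (u v : 'rV[R]_n) : 'rV[R]_n :=
  \row_i gm l (u ord0 i) (v ord0 i).

Lemma pos_rV_cons n (a : R) (u : 'rV[R]_n) :
  0 < a -> pos_rV u -> pos_rV (rV_cons (a, u)).
Proof.
move=> a0 u0 i; have [j ->|->] := unliftP ord0 i; first by rewrite rV_consS.
by rewrite rV_cons0.
Qed.

Lemma gm_rV_cons n (a b : R) (u v : 'rV[R]_n) :
  gm_rV (rV_cons (a, u)) (rV_cons (b, v)) = rV_cons (gm l a b, gm_rV u v).
Proof.
apply/rowP => i; rewrite mxE; have [j ->|->] := unliftP ord0 i.
  by rewrite !rV_consS mxE.
by rewrite !rV_cons0.
Qed.

(** The middle clause exists for the induction: a pair of fibres over distinct first coordinates has
    no diagonal, so strictness holds on all of it and has to exclude equality of the integrals. The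
    last clause serves fibres over the same coordinate. *)
Definition pl_property n : Prop := forall F G H : 'rV[R]_n -> R,
  good tau F -> good tau G -> good tau H ->
  (forall u v, pos_rV u -> pos_rV v -> gm l (F u) (G v) <= H (gm_rV u v)) ->
  [/\ gm l (I F) (I G) <= I H,
    (forall u v, pos_rV u -> pos_rV v -> gm l (F u) (G v) < H (gm_rV u v)) ->
      I H <> gm l (I F) (I G) &
    (forall u v, pos_rV u -> pos_rV v -> u <> v ->
        gm l (F u) (G v) < H (gm_rV u v)) ->
      I H = gm l (I F) (I G) ->
      forall u, pos_rV u -> F u = I F / I G * G u].

Let pl0 : pl_property 0.
Proof.
move=> F G H [cF F0 _ _] [cG G0 _ _] [cH _ _ _] FGH.
have p0 : pos_rV (0 : 'rV[R]_0) by case.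
have E (u : 'rV[R]_0) : u = 0 by apply/rowP => -[].
rewrite !Rintegral_rV0//; split.
- by rewrite -[X in H X](E (gm_rV 0 0)) FGH.
- move=> /(_ 0 0 p0 p0); rewrite [X in H X]E => /[swap] ->.
  by rewrite ltxx.
- by move=> _ _ u _; rewrite (E u) divfK// gt_eqF.
Qed.

Let plS n : pl_property n -> pl_property n.+1.
Proof.
move=> IH F G H gF gG gH FGH.
(* The induction hypothesis on the fibres over [a], [b] and [gm l a b]; [eq_ind] transports the
   pointwise hypothesis along [gm_rV_cons]. Its first clause is the one-dimensional hypothesis for
   the marginals. *)
have IHs (a b : R) : 0 < a -> 0 < b -> _ := fun a0 b0 =>
  IH _ _ _ (good_section a gF) (good_section b gG) (good_section (gm l a b) gH)
  (fun u v u0 v0 => eq_ind _ (fun w => _ <= H w)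
     (FGH _ _ (pos_rV_cons a0 u0) (pos_rV_cons b0 v0)) _ (gm_rV_cons a b u v)).
have FGH1 (a b : R) : 0 < a -> 0 < b ->
    gm l (marginal F a) (marginal G b) <= marginal H (gm l a b).
  by move=> a0 b0; have [] := IHs _ _ a0 b0.
have cM (K : 'rV[R]_n.+1 -> R) : good tau K -> continuous (marginal K).
  exact: marginal_continuous.
have M0 (K : 'rV[R]_n.+1 -> R) : good tau K -> forall a, 0 < marginal K a.
  by move=> gK a; exact: marginal_gt0 gK.
have iM (K : 'rV[R]_n.+1 -> R) : good tau K ->
    (@lebesgue_measure R).-integrable `[0, +oo[ (EFin \o marginal K).
  exact: marginal_integrable.
have line := pl_line l_gt0 l_lt1 (cM _ gF) (M0 _ gF) (iM _ gF)
  (cM _ gG) (M0 _ gG) (iM _ gG) (cM _ gH) (M0 _ gH) (iM _ gH) FGH1.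
have line_eq := pl_line_eq l_gt0 l_lt1 (cM _ gF) (M0 _ gF) (iM _ gF)
  (cM _ gG) (M0 _ gG) (iM _ gG) (cM _ gH) (M0 _ gH) (iM _ gH) FGH1.
have hF : 0 < halfint (marginal F) by apply: halfint_gt0; auto.
have hG : 0 < halfint (marginal G) by apply: halfint_gt0; auto.
have two0 : (2 : R) != 0 by [].
rewrite !(Rintegral_marginal tau_gt1)// gmZ ?(ltW hF) ?(ltW hG)//.
split.
- by rewrite ler_pM2l ?ltr0n//; exact: line.
(* The point 1 is an arbitrary choice: equality on the line at one point already yields a pair of
   fibres with equality, which the middle clause of [IH] excludes. *)
- move=> strict /(mulfI two0)/line_eq /(_ 1 ltr01)[b [b0 _]].
  have [_ + _] := IHs _ _ ltr01 b0; apply => u v u0 v0.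
  by rewrite -gm_rV_cons; apply: strict; exact: pos_rV_cons.
move=> strict /(mulfI two0) E.
(* The partner [b] of [a] must be [a] itself: if they differ, strictness holds for all pairs of
   points of the two fibres, against the middle clause of [IH]. *)
have diag (a : R) : 0 < a ->
    prim (marginal G) a =
      halfint (marginal G) / halfint (marginal F) * prim (marginal F) a /\
    marginal H a = gm l (marginal F a) (marginal G a).
  move=> a0; have [b [b0 pb Hb]] := line_eq E _ a0.
  have [ab|ab] := eqVneq a b; first by move: pb Hb; rewrite -ab gmxx// ltW.
  have [_ + _] := IHs _ _ a0 b0; case/(_ _ Hb) => u v u0 v0.
  rewrite -gm_rV_cons; apply: strict; [exact: pos_rV_cons|exact: pos_rV_cons|].
  by move=> /(congr1 rV_uncons); rewrite !rV_consK => -[/eqP]; rewrite (negbTE ab).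
(* The transport is the identity, so the primitives of the marginals are proportional;
   differentiating gives the marginals. *)
have dens (a : R) : 0 < a ->
    marginal G a = halfint (marginal G) / halfint (marginal F) * marginal F a.
  move=> a0; set c := _ / _ in diag *.
  have d1 := is_derive_prim (cM _ gG) (iM _ gG) a0.
  have dF := is_derive_prim (cM _ gF) (iM _ gF) a0.
  have d2 : is_derive a 1 (fun x => c * prim (marginal F) x) (c * marginal F a).
    exact: is_deriveZ.
  have N : \near a, c * prim (marginal F) a = prim (marginal G) a.
    near=> x; have x0 : 0 < x by near: x; exact: lt_nbhsr.
    by have [-> _] := diag _ x0.
  have [_ <-] := d1; have [_ <-] := near_eq_is_derive N d2.
  by [].
move=> w w0; rewrite -(rV_unconsK w); case: (rV_uncons w) (rV_unconsK w) => a u wE.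
have a0 : 0 < a by have := w0 ord0; rewrite -wE rV_cons0.
have u0 : pos_rV u by move=> i; have := w0 (lift ord0 i); rewrite -wE rV_consS.
(* The last clause of [IH] gives proportionality on the fibre over [a]; by [dens] its factor is the
   same for all [a]. *)
have [_ _] := IHs _ _ a0 a0; rewrite (gmxx l_lt1 (ltW a0)).
move=> -> //.
- rewrite -/(marginal F a) -/(marginal G a) dens//; congr (_ * _).
  have Fa : marginal F a != 0 by rewrite gt_eqF// M0.
  by rewrite invfM mulrCA divff// mulr1 invf_div -mulf_div divff// mul1r.
- move=> v1 v2 v10 v20 v12.
  have -> : rV_cons (a, gm_rV v1 v2) = gm_rV (rV_cons (a, v1)) (rV_cons (a, v2)).
    by rewrite gm_rV_cons gmxx// ltW.
  apply: strict; [exact: pos_rV_cons|exact: pos_rV_cons|].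
  by move=> /(congr1 rV_uncons); rewrite !rV_consK => -[].
- by have [_] := diag _ a0; exact.
Unshelve. all: by end_near. Qed.

Theorem prekopa_leindler_rV n : pl_property n.
Proof. by elim: n => [|n]; [exact: pl0|exact: plS]. Qed.

End prekopa_leindler_rV.

(** * Unconditional bodies *)

Section continuous_sum.
Context {R : realType}.

Lemma continuous_sumr (T : topologicalType) (I : Type) (r : seq I)
    (f : I -> T -> R) : (forall i, continuous (f i)) ->
  continuous (fun t => \sum_(i <- r) f i t).
Proof.
move=> cf; elim: r => [|i r IH] t.
  rewrite (_ : (fun _ => _) = cst 0); first exact: cvg_cst.
  by apply/funext => s; rewrite big_nil.
rewrite (_ : (fun _ => _) = (fun t => f i t + \sum_(j <- r) f j t)).
  by apply: cvgD; [exact: cf|exact: IH].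
by apply/funext => s; rewrite big_cons.
Qed.

Lemma continuous_subf (T : topologicalType) (f g : T -> R) :
  continuous f -> continuous g -> continuous (fun t => f t - g t).
Proof. by move=> cf cg t; apply: cvgB; [exact: cf|exact: cg]. Qed.

End continuous_sum.

Section inner_product.
Context {R : realType} {n : nat}.
Implicit Types (x y z : 'rV[R]_n) (K : set 'rV[R]_n).

Lemma dotvDl x y z : dotv (x + y) z = dotv x z + dotv y z.
Proof. by rewrite -big_split; apply: eq_bigr => i _; rewrite mxE mulrDl. Qed.

Lemma dotvZl (a : R) x y : dotv (a *: x) y = a * dotv x y.
Proof. by rewrite mulr_sumr; apply: eq_bigr => i _; rewrite mxE mulrA. Qed.

Lemma dotvC x y : dotv x y = dotv y x.
Proof. by apply: eq_bigr => i _; rewrite mulrC. Qed.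

Lemma dotvNl x y : dotv (- x) y = - dotv x y.
Proof. by rewrite -scaleN1r dotvZl mulN1r. Qed.

Lemma dotvBl x y z : dotv (x - y) z = dotv x z - dotv y z.
Proof. by rewrite dotvDl dotvNl. Qed.

Lemma dotv_subZ x y (t : R) : dotv (x - t *: y) (x - t *: y) =
  dotv x x - t * (2 * dotv y x - t * dotv y y).
Proof.
rewrite dotvBl (dotvC x) (dotvC (t *: y)) !dotvBl (dotvC x (t *: y)) !dotvZl.
rewrite (dotvC y (t *: y)) dotvZl; ring.
Qed.

Lemma dotv_ge0 x : 0 <= dotv x x.
Proof. by apply: sumr_ge0 => i _; rewrite -expr2 sqr_ge0. Qed.

Lemma dotv_eq0 x : dotv x x = 0 -> x = 0.
Proof.
move=> /psumr_eq0P H; apply/rowP => i; rewrite mxE; apply/eqP.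
by rewrite -sqrf_eq0 expr2 H// => j _; rewrite -expr2 sqr_ge0.
Qed.

Lemma enorm_eq1 x : enorm x = 1 <-> dotv x x = 1.
Proof.
split; last by rewrite /enorm => ->; rewrite sqrtr1.
by move=> /(congr1 (fun t => t ^+ 2)); rewrite sqr_sqrtr ?dotv_ge0// expr1n.
Qed.

Lemma enorm_normalize x : x != 0 -> enorm ((enorm x)^-1 *: x) = 1.
Proof.
move=> x0; have d0 : 0 < dotv x x.
  by rewrite lt_neqAle dotv_ge0 andbT eq_sym; apply: contra_neq x0; exact: dotv_eq0.
apply/enorm_eq1; rewrite dotvZl dotvC dotvZl mulrA -expr2 exprVn.
by rewrite /enorm sqr_sqrtr ?dotv_ge0// mulVf// gt_eqF.
Qed.

Lemma dotv_reflect i x y :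
  dotv (reflect_coord i x) y = dotv x (reflect_coord i y).
Proof.
by apply: eq_bigr => j _; rewrite !mxE; case: eqP => // _; rewrite mulNr mulrN.
Qed.

Lemma reflect_coordK i : involutive (@reflect_coord R n i).
Proof.
by move=> x; apply/rowP => j; rewrite !mxE; case: eqP => // _; rewrite opprK.
Qed.

Lemma enorm_reflect i x : enorm (reflect_coord i x) = enorm x.
Proof. by rewrite /enorm dotv_reflect reflect_coordK. Qed.

Lemma continuous_dotv (T : topologicalType) (f g : T -> 'rV[R]_n) :
  continuous f -> continuous g -> continuous (fun t => dotv (f t) (g t)).
Proof.
move=> cf cg; apply: continuous_sumr => i t.
have coord (h : T -> 'rV[R]_n) : continuous h -> continuous (fun t => h t ord0 i).
  move=> ch s; suff : {for s, continuous ((fun u : 'rV[R]_n => u ord0 i) \o h)} by [].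
  by apply: continuous_comp; [exact: ch|exact: coord_continuous].
by apply: cvgM; exact: coord.
Qed.

Definition sgv x : 'rV[R]_n := \row_i Num.sg (x ord0 i).

Lemma dotv_sgv x : dotv (sgv x) x = \sum_i `|x ord0 i|.
Proof. by apply: eq_bigr => i _; rewrite mxE [RHS]normrEsg. Qed.

Lemma dotv_le_norm1 (r : R) x y : (forall i, `|x ord0 i| <= r) ->
  dotv x y <= r * \sum_i `|y ord0 i|.
Proof.
move=> xr; rewrite mulr_sumr; apply: ler_sum => i _.
by rewrite (le_trans (ler_norm _))// normrM ler_wpM2r.
Qed.

(* Flip the coordinates of [x] to those of [y] one index at a time. *)
Lemma reflect_invariant T (f : 'rV[R]_n -> T) x y :
  (forall i z, f (reflect_coord i z) = f z) ->
  (forall i, `|x ord0 i| = `|y ord0 i|) -> f x = f y.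
Proof.
move=> fr xy.
pose z k : 'rV[R]_n := \row_i (if (i < k)%N then y ord0 i else x ord0 i).
have zf k : (k <= n)%N -> f (z k) = f x.
  elim: k => [_|k IH kn].
    by congr f; apply/rowP => i; rewrite mxE.
  rewrite -IH ?(ltnW kn)//; pose i0 := Ordinal kn.
  have [E|E] := eqVneq (y ord0 i0) (x ord0 i0).
    congr f; apply/rowP => i; rewrite !mxE ltnS leq_eqVlt.
    have -> : (i == k :> nat) = (i == i0) by [].
    by have [->|//] := eqVneq i i0; rewrite ltnn E.
  rewrite -(fr i0); congr f; apply/rowP => i; rewrite !mxE ltnS leq_eqVlt.
  have -> : (i == k :> nat) = (i == i0) by [].
  have [->|//] := eqVneq i i0.
  rewrite ltnn /=; have /eqP := xy i0.
  rewrite eqr_norm2 => /orP[/eqP/esym/eqP|/eqP->//].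
  by rewrite (negbTE E).
rewrite -(zf n (leqnn n)); congr f; apply/rowP => i.
by rewrite mxE ltn_ord.
Qed.

End inner_product.

Section support_function.
Context {R : realType} {n : nat}.
Implicit Types (x y : 'rV[R]_n) (K : set 'rV[R]_n).

Lemma support_ub K (B : R) x y : (forall z, K z -> forall i, `|z ord0 i| <= B) ->
  K x -> dotv x y <= support_fun K y.
Proof.
move=> KB Kx; apply: ub_le_sup; last by exists x.
exists (B * \sum_i `|y ord0 i|) => _ [z Kz <-].
exact/dotv_le_norm1/KB.
Qed.

Lemma support_le K x y (b : R) : K x -> (forall z, K z -> dotv z y <= b) ->
  support_fun K y <= b.
Proof.
move=> Kx Kb; apply: ge_sup; first by exists (dotv x y); exists x.
by move=> _ [z Kz <-]; exact: Kb.
Qed.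

Lemma convexP K : convex_set K -> forall x y (t : R), 0 <= t -> t <= 1 ->
  K x -> K y -> K (t *: x + (1 - t) *: y).
Proof.
move=> cK x y t t0 t1 Kx Ky.
by have := cK x y (Itv01 t0 t1) (mem_set Kx) (mem_set Ky); rewrite inE.
Qed.

Lemma compact_coord_bounded K : compact K ->
  exists B : R, forall z, K z -> forall i, `|z ord0 i| <= B.
Proof.
move=> /compact_bounded[M [_ MK]]; exists (M + 1) => z Kz i.
by rewrite (le_trans (row_coord_le _ _))// MK// ltrDl.
Qed.

(** Separation through the point [p] of [K] nearest to [x]: if [x] is outside [K], then [w = x - p]
    is an outer normal at [p], and its direction violates the support inequality. *)
Lemma support_separation K x : compact K -> convex_set K -> K !=set0 ->
  (forall y, enorm y = 1 -> dotv x y <= support_fun K y) -> K x.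
Proof.
move=> cK /convexP vK K0 xK; apply: contrapT => nKx.
pose d p := dotv (x - p) (x - p).
have cd : continuous d.
  have cs : continuous (fun p : 'rV[R]_n => x - p).
    apply: continuous_rowP => i.
    rewrite (_ : (fun _ => _) = (fun p : 'rV[R]_n => x ord0 i - p ord0 i)).
      by apply: continuous_subf; [exact: cst_continuous|exact: coord_continuous].
    by apply/funext => q; rewrite !mxE.
  exact: continuous_dotv.
have [p] := EVT_min_rV K0 cK (continuous_subspaceT cd).
rewrite inE => Kp pmin; pose w := x - p.
have w0 : w != 0.
  by rewrite subr_eq0; apply/eqP => xp; apply: nKx; rewrite xp.
have side k : K k -> dotv k w <= dotv p w.
  move=> Kk; rewrite -subr_le0 -dotvBl leNgt; apply/negP => a0.
  set a := dotv (k - p) w in a0; pose b := dotv (k - p) (k - p).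
  have b0 : 0 <= b by exact: dotv_ge0.
  (* This [t] stays in (0, 1] and satisfies t b < 2 a, so moving from [p] towards [k] by [t] would
     strictly decrease the distance to [x]. *)
  pose t := a / (a + b).
  have ab : 0 < a + b by rewrite ltr_wpDr.
  have t0 : 0 < t by rewrite divr_gt0.
  have t1 : t <= 1 by rewrite ler_pdivrMr// mul1r lerDl.
  have := pmin (t *: k + (1 - t) *: p); rewrite inE => /(_ (vK _ _ _ (ltW t0) t1 Kk Kp)).
  have -> : d (t *: k + (1 - t) *: p) = d p - t * (2 * a - t * b).
    rewrite /d (_ : x - _ = w - t *: (k - p)); last first.
      by apply/rowP => i; rewrite !mxE; ring.
    by rewrite dotv_subZ.
  rewrite lerDl oppr_ge0 pmulr_rle0// leNgt subr_gt0.
  move=> /negP; apply; rewrite /t mulrAC ltr_pdivrMr//.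
  by rewrite mulrDr -subr_gt0; nra.
have e0 : 0 < (enorm w)^-1.
  rewrite invr_gt0 lt_neqAle sqrtr_ge0 andbT eq_sym.
  apply/eqP => e0; have := enorm_normalize w0.
  rewrite e0 invr0 scale0r => /enorm_eq1; rewrite -(scale0r 0) dotvZl mul0r.
  by move=> /esym/eqP; rewrite oner_eq0.
have := xK _ (enorm_normalize w0); apply/negP; rewrite -ltNge.
apply: (@le_lt_trans _ _ (dotv p ((enorm w)^-1 *: w))).
  apply: (support_le Kp) => k /side.
  by rewrite !(dotvC _ (_ *: _)) !dotvZl !(dotvC w) ler_pM2l.
rewrite -subr_gt0 -dotvBl -/w dotvC dotvZl mulr_gt0//.
by rewrite lt_neqAle dotv_ge0 andbT eq_sym; apply: contra_neq w0; exact: dotv_eq0.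
Qed.

End support_function.

Section unconditional_bodies.
Context {R : realType} {n : nat}.
Implicit Types (x y : 'rV[R]_n) (K L : set 'rV[R]_n).

(** Unconditional bodies described by points rather than support functions: closed and bounded for
    compact, a cube around the origin for nonempty interior. In this form the properties can be
    checked directly on an L_0-sum. *)
Definition ubody K : Prop :=
  [/\ closed K,
      forall x y (t : R), 0 <= t -> t <= 1 -> K x -> K y -> K (t *: x + (1 - t) *: y),
      forall i x, K x -> K (reflect_coord i x),
      exists2 r : R, 0 < r & forall x, (forall i, `|x ord0 i| <= r) -> K x &
      exists B : R, forall x, K x -> forall i, `|x ord0 i| <= B].

Lemma coord_sgv_le1 x i : `|sgv x ord0 i| <= 1.
Proof. by rewrite mxE normr_sg; case: eqP. Qed.

Lemma support_abs K x y : unconditional K ->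
  (forall i, `|x ord0 i| = `|y ord0 i|) -> support_fun K x = support_fun K y.
Proof. by move=> uK; apply: reflect_invariant => i z; exact: uK. Qed.

(** Separation converts statements on the support function into membership. For the cube: a ball
    around [x0] bounds [support_fun K] from below at [y] and at [- y], where its values agree;
    averaging cancels [dotv x0 y] and leaves (e / 2) |y|_1, the support function of the cube of
    half-side e / 2. *)
Lemma convex_body_ubody K : convex_body K -> unconditional K -> ubody K.
Proof.
move=> [cK vK [x0 ix0]] uK.
have [B KB] := compact_coord_bounded cK.
have K0 : K !=set0 by exists x0; exact: interior_subset.
have Ksep x := @support_separation _ _ K x cK vK K0.
split; [|exact: convexP| | |by exists B].
- by apply: compact_closed cK; exact: norm_hausdorff.
- move=> i x Kx; apply: Ksep => y y1.
  by rewrite dotv_reflect -(uK i); exact: support_ub KB Kx.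
- have /nbhs_ballP[e /= e0 eK] : nbhs x0 K by exact: ix0.
  exists (e / 2); first by rewrite divr_gt0.
  move=> x xe; apply: Ksep => y _; apply: (le_trans (dotv_le_norm1 y xe)).
  have KD (s : 'rV[R]_n) : (forall i, `|s ord0 i| <= 1) -> K (x0 + (e / 2) *: s).
    move=> s1; apply: eK; rewrite -ball_normE/=; apply/row_norm_lt; split => // i.
    rewrite !mxE opprD addNKr normrN normrM gtr0_norm ?divr_gt0//.
    by apply: (@le_lt_trans _ _ (e / 2 * 1)); [rewrite ler_pM2l ?divr_gt0|lra].
  have sN : support_fun K y = support_fun K (- y).
    by apply: support_abs => // i; rewrite mxE normrN.
  have h1 := support_ub y KB (KD _ (coord_sgv_le1 y)).
  have h2 := support_ub (- y) KB (KD _ (coord_sgv_le1 (- y))).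
  have E (z : 'rV[R]_n) : dotv (x0 + (e / 2) *: sgv z) z =
      dotv x0 z + e / 2 * \sum_i `|z ord0 i|.
    by rewrite dotvDl dotvZl dotv_sgv.
  rewrite E in h1; rewrite E -sN dotvC dotvNl dotvC in h2.
  have N : \sum_i `|(- y) ord0 i| = \sum_i `|y ord0 i|.
    by apply: eq_bigr => i _; rewrite mxE normrN.
  rewrite N in h2.
  move: h1 h2; set a := dotv x0 y; set b := _ * _; set h := support_fun K y.
  move=> h1 h2; lra.
Qed.

Lemma support_ge_norm1 K (r : R) y : 0 < r -> ubody K ->
  (forall x, (forall i, `|x ord0 i| <= r) -> K x) ->
  r * \sum_i `|y ord0 i| <= support_fun K y.
Proof.
move=> r0 [_ _ _ _ [B KB]] Kr; rewrite -dotv_sgv -dotvZl.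
apply: support_ub KB _; apply: Kr => i.
by rewrite mxE normrM gtr0_norm// ler_piMr ?(ltW r0)// coord_sgv_le1.
Qed.

Lemma ubody0 K : ubody K -> K 0.
Proof. by case=> _ _ _ [r r0 Kr] _; apply: Kr => i; rewrite mxE normr0 ltW. Qed.

Lemma support_ge0 K y : ubody K -> 0 <= support_fun K y.
Proof.
move=> bK; have [_ _ _ _ [B KB]] := bK.
have <- : dotv 0 y = 0 by rewrite -(scale0r (0 : 'rV[R]_n)) dotvZl mul0r.
exact: support_ub KB (ubody0 bK).
Qed.

Variable l : R.
Hypotheses (l_gt0 : 0 < l) (l_lt1 : l < 1).

Lemma L0_sum_ubody K L : ubody K -> unconditional K -> ubody L -> unconditional L ->
  ubody (L0_sum l K L).
Proof.
move=> bK uK bL uL.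
have [_ _ _ [rK rK0 Kr] [BK KB]] := bK; have [_ _ _ [rL rL0 Lr] [BL LB]] := bL.
split.
- rewrite (_ : L0_sum l K L = \bigcap_(y in [set y | enorm y = 1])
      (dotv^~ y @^-1` [set t | t <= gm l (support_fun K y) (support_fun L y)])).
    apply: closed_bigI => y _; apply: closed_comp; last exact: closed_le.
    move=> x _; suff : continuous (fun x : 'rV[R]_n => dotv x y) by exact.
    by apply: continuous_dotv => z; [exact: cvg_id|exact: cst_continuous].
  by apply/seteqP; split => x.
- move=> x y t t0 t1 Mx My e e1.
  have -> : support_fun K e `^ (1 - l) * support_fun L e `^ l =
    t * (support_fun K e `^ (1 - l) * support_fun L e `^ l) +
    (1 - t) * (support_fun K e `^ (1 - l) * support_fun L e `^ l) by ring.
  rewrite dotvDl !dotvZl; apply: lerD.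
    by apply: ler_wpM2l => //; exact: Mx.
  by apply: ler_wpM2l; [rewrite subr_ge0|exact: My].
- move=> i x Mx e e1; rewrite dotv_reflect -(uK i) -(uL i).
  by apply: Mx; rewrite enorm_reflect.
(* The support functions are at least rK |e|_1 and rL |e|_1, and the mean of these bounds is
   [gm l rK rL] times |e|_1. *)
- exists (gm l rK rL); first exact: gm_gt0.
  move=> x xr e e1; apply: (le_trans (dotv_le_norm1 e xr)).
  have s0 : 0 <= \sum_i `|e ord0 i| by exact: sumr_ge0.
  rewrite -[X in _ * X](gmxx l_lt1 s0) -gmM ?(ltW rK0) ?(ltW rL0)//.
  apply: gm_le => //; rewrite ?mulr_ge0 ?(ltW rK0) ?(ltW rL0)//.
    exact: support_ge_norm1.
  exact: support_ge_norm1.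
- exists (gm l BK BL) => x Mx i.
  (* Testing the defining inequality at the two unit vectors along axis [i] bounds that coordinate
     from both sides. *)
  pose e (s : R) : 'rV[R]_n := s *: delta_mx 0 i.
  have dE z s : dotv z (e s) = s * z ord0 i.
    rewrite dotvC dotvZl; congr (_ * _); rewrite /dotv (bigD1 i)//= big1 ?addr0.
      by rewrite mxE !eqxx mul1r.
    by move=> j /negbTE ji; rewrite mxE ji andbF mul0r.
  have Me s : `|s| = 1 -> s * x ord0 i <= gm l BK BL.
    move=> s1; rewrite -dE.
    have s2 : s * s = 1 by rewrite -expr2 -real_normK ?num_real// s1 expr1n.
    apply: (le_trans (Mx (e s) _)).
      by apply/enorm_eq1; rewrite dE /e !mxE !eqxx mulr1.
    apply: gm_le => //; [exact: support_ge0|exact: support_ge0| |].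
      apply: (support_le (ubody0 bK)) => z Kz; rewrite dE.
      by rewrite (le_trans (ler_norm _))// normrM s1 mul1r; exact: KB.
    apply: (support_le (ubody0 bL)) => z Lz; rewrite dE.
    by rewrite (le_trans (ler_norm _))// normrM s1 mul1r; exact: LB.
  rewrite ler_norml; apply/andP; split.
    by rewrite lerNl -mulN1r; apply: Me; rewrite normrN normr1.
  by rewrite -[X in X <= _]mul1r; apply: Me; rewrite normr1.
Qed.

(** Unconditionality replaces the test direction [e] by the vector [a] of its absolute values; all
    products are then nonnegative and Hölder's inequality applies to the sums [dotv x a] and
    [dotv y a]. *)
Lemma gm_rV_L0_sum K L x y : ubody K -> unconditional K -> ubody L ->
  unconditional L -> K x -> L y -> pos_rV x -> pos_rV y ->
  L0_sum l K L (gm_rV l x y).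
Proof.
move=> [_ _ _ _ [BK KB]] uK [_ _ _ _ [BL LB]] uL Kx Ly x0 y0 e e1.
pose a : 'rV[R]_n := \row_i `|e ord0 i|.
have hK : support_fun K e = support_fun K a.
  by apply: support_abs => // i; rewrite mxE normr_id.
have hL : support_fun L e = support_fun L a.
  by apply: support_abs => // i; rewrite mxE normr_id.
have pa z : pos_rV z -> 0 <= dotv z a.
  by move=> z0; apply: sumr_ge0 => i _; rewrite mxE mulr_ge0// ltW.
apply: (@le_trans _ _ (gm l (dotv x a) (dotv y a))); last first.
  rewrite hK hL; apply: gm_le => //; [exact: pa|exact: pa| |].
    exact: support_ub KB Kx.
  exact: support_ub LB Ly.
apply: le_trans (sum_gm_le l_gt0 l_lt1 _ _); last 2 first.
- by move=> i; rewrite mxE mulr_ge0// ltW.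
- by move=> i; rewrite mxE mulr_ge0// ltW.
(* The weight |e_i| is its own geometric mean, so it comes out of [gm] unchanged. *)
apply: ler_sum => i _; rewrite !mxE gmM ?(ltW (x0 i)) ?(ltW (y0 i))//.
rewrite gmxx// (le_trans (ler_norm _))// normrM ger0_norm//; exact: gm_ge0.
Qed.

End unconditional_bodies.

Section dilates.
Context {R : realType} {n : nat}.
Variable l : R.
Hypotheses (l_gt0 : 0 < l) (l_lt1 : l < 1).

Lemma support_dilate (K : set 'rV[R]_n) (c : R) y : ubody K -> 0 < c ->
  support_fun [set c *: x | x in K] y = c * support_fun K y.
Proof.
move=> bK c0; have [_ _ _ _ [B KB]] := bK.
apply/eqP; rewrite eq_le; apply/andP; split.
  apply: (@support_le _ _ _ (c *: 0)); first by exists 0 => //; exact: ubody0.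
  by move=> _ [x Kx <-]; rewrite dotvZl ler_pM2l//; exact: support_ub KB Kx.
rewrite mulrC -ler_pdivlMr//; apply: (support_le (ubody0 bK)) => z Kz.
rewrite ler_pdivlMr// mulrC -dotvZl.
apply: (@support_ub _ _ _ (c * B)); last by exists z.
by move=> _ [x Kx <-] i; rewrite mxE normrM gtr0_norm// ler_pM2l//; exact: KB.
Qed.

(** As h_{cK} = c h_K, the defining bound is c^l h_K, and separation recovers [K] from its support
    function. *)
Lemma L0_sum_dilate (K : set 'rV[R]_n) (c : R) :
  convex_body K -> unconditional K -> 0 < c ->
  L0_sum l K [set c *: x | x in K] = [set c `^ l *: x | x in K].
Proof.
move=> bK uK c0; have bK' := convex_body_ubody bK uK.
have [cK vK [x0 ix0]] := bK; have [_ _ _ _ [B KB]] := bK'.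
have k0 : 0 < c `^ l by exact: powR_gt0.
have gE y : support_fun K y `^ (1 - l) *
    support_fun [set c *: x | x in K] y `^ l = c `^ l * support_fun K y.
  rewrite support_dilate// -/(gm l _ _); apply: gm_mulr => //.
    exact: support_ge0.
  exact: ltW.
apply/seteqP; split => [x Mx|_ [x Kx <-] y _].
  exists ((c `^ l)^-1 *: x); last by rewrite scalerA mulfV ?scale1r// gt_eqF.
  apply: support_separation => //; first by exists x0; exact: interior_subset.
  move=> y y1; rewrite dotvZl mulrC ler_pdivrMr// mulrC -gE; exact: Mx.
by rewrite gE dotvZl ler_pM2l//; exact: support_ub KB Kx.
Qed.

End dilates.

(** * Polar coordinates *)

Section scaling.
Context {R : realType}.
Notation leb := (@lebesgue_measure R).
Local Open Scope ereal_scope.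

(** By uniqueness of Lebesgue measure, agreement on half-open intervals suffices. *)
Lemma lebesgue_measure_scale (r : R) (r0 : (0 < r)%R) (A : set R) : measurable A ->
  leb A = r%:E * leb ((fun x => r * x)%R @^-1` A).
Proof.
move=> mA.
have ms : @measurable_fun _ _ (measurableTypeR R) (measurableTypeR R) setT
    (fun x : R => r * x)%R.
  exact: mulrl_measurable.
pose phi : measurableTypeR R -> measurableTypeR R := fun x => (r * x)%R.
pose P' : {measure set (measurableTypeR R) -> \bar R} := pushforward leb phi.
pose P : {measure set (measurableTypeR R) -> \bar R} := P' ms.
pose k : {nonneg R} := NngNum (ltW r0).
have := @lebesgue_measure_unique R (mscale k P).
apply => //= _ [[a b]] _ <-.
rewrite /mscale/= /P /P' /pushforward /phi.
have -> : ((fun x : R => r * x)%R @^-1` [set` `]a, b]]) = [set` `](a / r)%R, (b / r)%R]].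
  apply/seteqP; split => x /=; rewrite !in_itv/= => /andP[].
    by move=> ax xb; rewrite ltr_pdivrMr// ler_pdivlMr// !(mulrC x) ax.
  by rewrite ltr_pdivrMr// ler_pdivlMr// !(mulrC x) => -> ->.
rewrite !lebesgue_measure_itv/= !lte_fin ltr_pM2r ?invr_gt0//.
case: ifPn => _; last by rewrite mule0.
by rewrite -!EFinB -EFinM -mulrBl mulrC divfK// gt_eqF.
Qed.

Lemma integral_scale (r : R) (f : R -> \bar R) : (0 < r)%R ->
  measurable_fun [set: R] f -> (forall x, 0 <= f x) ->
  \int[leb]_x f x = r%:E * \int[leb]_x f (r * x)%R.
Proof.
move=> r0 mf f0.
have ms : @measurable_fun _ _ (measurableTypeR R) (measurableTypeR R) setT
    (fun x : R => r * x)%R.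
  exact: mulrl_measurable.
pose phi : measurableTypeR R -> measurableTypeR R := fun x => (r * x)%R.
pose P' : {measure set (measurableTypeR R) -> \bar R} := pushforward leb phi.
pose P : {measure set (measurableTypeR R) -> \bar R} := P' ms.
pose k : {nonneg R} := NngNum (ltW r0).
transitivity (\int[mscale k P]_x f x).
  apply: eq_measure_integral => A mA _.
  exact: lebesgue_measure_scale.
rewrite ge0_integral_mscale//=; congr (_ * _).
by rewrite /P /P' (@ge0_integral_pushforward _ _ _ _ R _ ms leb setT f).
Qed.

Lemma integral_even (f : R -> \bar R) :
  measurable_fun [set: R] f -> (forall x, 0 <= f x) -> (forall x, f (- x)%R = f x) ->
  \int[leb]_x f x = 2%:E * \int[leb]_(x in `]0%R, +oo[) f x.
Proof.
move=> mf f0 even.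
have mfD (D : set R) : measurable_fun D f by exact: measurable_funTS.
rewrite -(setUv (`]-oo, 0%R] : set R)) ge0_integral_setU//=; last 3 first.
- exact: measurableC.
- by rewrite setUv.
- exact/disj_setPCl.
rewrite setCitvl mule_natl mule2n; congr (_ + _).
have := ge0_integration_by_substitution0 mf f0.
under [X in _ = X -> _]eq_integral do rewrite even.
by move=> <-; rewrite integral_itv_obnd_cbnd.
Qed.

Lemma measurable_scale_rV n (r : R) :
  measurable_fun [set: 'rV[R]_n] (fun x => r *: x)%R.
Proof.
apply/measurable_fun_rVP => i.
rewrite (_ : _ \o _ = fun x => (r * rV_coord i x)%R).
  by apply: measurable_funM => //; exact: measurable_rV_coord.
by apply/funext => x; rewrite /= /rV_coord mxE.
Qed.

Lemma measurable_rV_consr n (a : R) :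
  measurable_fun [set: 'rV[R]_n] (fun u => rV_cons (a, u)).
Proof.
have mp : measurable_fun [set: 'rV[R]_n] (fun u : 'rV[R]_n => (a, u)).
  exact: measurable_fun_pair.
by have := measurableT_comp (@measurable_rV_cons R n) mp.
Qed.

Lemma scale_rV_cons n (r a : R) (u : 'rV[R]_n) :
  (r *: rV_cons (a, u) = rV_cons (r * a, r *: u))%R.
Proof.
apply/rowP => i; rewrite mxE; have [j ->|->] := unliftP ord0 i.
  by rewrite !rV_consS mxE.
by rewrite !rV_cons0.
Qed.

Lemma integral_scale_rV n (r : R) (F : 'rV[R]_n -> \bar R) : (0 < r)%R ->
  measurable_fun [set: 'rV[R]_n] F -> (forall x, 0 <= F x) ->
  \int[lebesgue_rV n]_x F x = (r ^+ n)%:E * \int[lebesgue_rV n]_x F (r *: x)%R.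
Proof.
move=> r0; elim: n F => [|n IH] F mF F0.
  rewrite !integral_rV0 ?expr0 ?mul1e ?scaler0//.
  by apply: measurableT_comp => //; exact: measurable_scale_rV.
have mFr : measurable_fun [set: 'rV[R]_n.+1] (fun x => F (r *: x)%R).
  by apply: measurableT_comp => //; exact: measurable_scale_rV.
rewrite !integral_rVS// (integral_scale r0); last 2 first.
- exact: measurable_section_integral.
- by move=> a; exact: integral_ge0.
under eq_integral => a _.
  rewrite IH; last 2 first.
  - by apply: measurableT_comp => //; exact: measurable_rV_consr.
  - by move=> u; exact: F0.
  under [X in _ * X]eq_integral => u _ do rewrite -scale_rV_cons.
  over.
rewrite /= ge0_integralZl_EFin//; last 3 first.
- by move=> a _; exact: integral_ge0.
- exact: measurable_section_integral mFr _.
- by rewrite exprn_ge0// ltW.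
by rewrite muleA -EFinM exprS.
Qed.

(* Polar coordinates [x = r (1, u)]; [G] even in the first coordinate accounts
   for the factor [2] and the restriction to [r > 0]. *)
Lemma integral_polar n (G : 'rV[R]_n.+1 -> \bar R) :
  measurable_fun [set: 'rV[R]_n.+1] G -> (forall x, 0 <= G x) ->
  (forall x, G (reflect_coord ord0 x) = G x) ->
  \int[lebesgue_rV n.+1]_x G x =
  2%:E * \int[lebesgue_rV n]_u \int[leb]_(r in `]0%R, +oo[)
    ((r ^+ n)%:E * G (r *: rV_cons (1%R, u))%R).
Proof.
move=> mG G0 evenG.
rewrite integral_rVS// integral_even; last 3 first.
- exact: measurable_section_integral.
- by move=> a; exact: integral_ge0.
- by move=> a; under eq_integral do rewrite -reflect_rV_cons0 evenG.
congr (_ * _).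
(* The indicator extends the integrand to all real [r], so that Tonelli's theorem applies on the
   full product; r^n is the Jacobian of u |-> r u in the hyperplane. *)
pose f (p : measurableTypeR R * 'rV[R]_n) : \bar R :=
  ((\1_(`]0%R, +oo[ : set R) p.1 : R) * p.1 ^+ n)%:E * G (p.1 *: rV_cons (1%R, p.2))%R.
have f0 p : 0 <= f p.
  rewrite /f indicE; case: (boolP (_ \in _)) => [|_]; last by rewrite mul0r mul0e.
  by rewrite inE/= in_itv/= andbT => p0; rewrite mul1r mule_ge0// lee_fin exprn_ge0// ltW.
have mf : measurable_fun setT f.
  apply: emeasurable_funM.
    apply/measurable_EFinP; apply: measurable_funM.
      have mI : measurable_fun [set: measurableTypeR R]
          (\1_(`]0%R, +oo[ : set R) : R -> R).
        exact: measurable_indic.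
      exact: (measurableT_comp mI measurable_fst).
    by apply: measurable_funX; exact: measurable_fst.
  apply: measurableT_comp => //; apply/measurable_fun_rVP => i.
  have [j ->|->] := unliftP ord0 i.
    rewrite (_ : _ \o _ = (fun p => p.1 * rV_coord j p.2)%R).
      apply: measurable_funM => //.
      by apply: measurableT_comp => //; exact: measurable_rV_coord.
    by apply/funext => p; rewrite /= /rV_coord mxE rV_consS.
  rewrite (_ : _ \o _ = fst)//.
  by apply/funext => p; rewrite /= /rV_coord mxE rV_cons0/= mulr1.
transitivity (\int[leb]_r \int[lebesgue_rV n]_u f (r, u)).
  rewrite integral_mkcond; apply: eq_integral => r _.
  rewrite patchE /f/= indicE; case: ifPn => [|_]; last first.
    by rewrite integral0_eq// => u _; rewrite mul0r mul0e.
  rewrite inE/= in_itv/= andbT => r0.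
  rewrite (integral_scale_rV r0); last 2 first.
  - by apply: measurableT_comp => //; exact: measurable_rV_consr.
  - by move=> u; exact: G0.
  rewrite -ge0_integralZl_EFin//; last 2 first.
  - apply: (@measurableT_comp _ _ _ _ _ _ (fun w => G (rV_cons (r, w))));
      last exact: measurable_scale_rV.
    by apply: measurableT_comp => //; exact: measurable_rV_consr.
  - by rewrite exprn_ge0// ltW.
  by apply: eq_integral => u _; rewrite mul1r scale_rV_cons mulr1.
rewrite (@fubini_tonelli _ _ _ _ _ leb (lebesgue_rV n) f mf f0).
apply: eq_integral => u _; rewrite [RHS]integral_mkcond; apply: eq_integral => r _.
rewrite patchE /f/= indicE; case: ifPn => _; first by rewrite mul1r.
by rewrite mul0r mul0e.
Qed.

(** The integrand may be singular at 0, so the fundamental theorem of calculus is applied on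
    [[e k, a]], and these intervals exhaust []0, a]] by monotone convergence. *)
Lemma integral_powR (q a : R) : (0 < q)%R -> (0 < a)%R ->
  \int[leb]_(r in `]0%R, a]) (r `^ (q - 1))%:E = (a `^ q / q)%:E.
Proof.
move=> q0 a0.
(* With [k.+2], the strict inequality [e k < a] holds already at [k = 0]. *)
pose e (k : nat) : R := (a / k.+2%:R)%R.
have e0 k : (0 < e k)%R by rewrite divr_gt0.
have ea k : (e k < a)%R by rewrite ltr_pdivrMr// ltr_pMr// ltr1n.
have E : \bigcup_k `[e k, a]%classic = `]0%R, a]%classic :> set R.
  apply/seteqP; split => [r [k _]/=|r /=]; rewrite !in_itv/= => /andP[r1 r2].
    by rewrite r2 andbT (lt_le_trans (e0 k)).
  exists (Num.truncn (a / r)).+1 => //=; rewrite in_itv/= r2 andbT.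
  rewrite ler_pdivrMr// mulrC -ler_pdivrMr// ltW//.
  by apply: lt_le_trans (truncnS_gt _) _; rewrite ler_nat !ltnS leqW.
have H : \int[leb]_(r in `[e k, a]) (r `^ (q - 1))%:E @[k --> \oo] -->
    \int[leb]_(r in `]0%R, a]) (r `^ (q - 1))%:E.
  rewrite -E; apply: ge0_nondecreasing_set_cvg_integral => //.
  - move=> i j ij; apply/subsetPset; apply: subset_itvr; rewrite bnd_simp.
    by rewrite ler_pM2l// lef_pV2 ?posrE// ler_nat.
  - by move=> k; apply/measurable_EFinP; apply: measurable_funTS; exact: measurable_powR.
  - by move=> k r _; rewrite lee_fin powR_ge0.
have V k : \int[leb]_(r in `[e k, a]) (r `^ (q - 1))%:E =
    ((a `^ q - e k `^ q) / q)%:E.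
  pose F (r : R) := (q^-1 * r `^ q)%R.
  have dF (r : R) : (0 < r)%R -> is_derive r 1%R F (r `^ (q - 1))%R.
    move=> r0; have d := is_derive1_powR q r0.
    have -> : (r `^ (q - 1) = q^-1 * (q * r `^ (q - 1)))%R.
      by rewrite mulrA mulVf ?mul1r// gt_eqF.
    exact: is_deriveZ.
  have cF (r : R) : (0 < r)%R -> {for r, continuous F}.
    move=> /dF[d _]; apply: differentiable_continuous; exact/derivable1_diffP.
  rewrite (@continuous_FTC2 R _ F).
  - by rewrite /F -EFinB -mulrBr mulrC.
  - exact: ea.
  - apply: continuous_in_subspaceT => r; rewrite inE/= in_itv/= => /andP[r1 _].
    by apply: powR_continuous_pos; exact: lt_le_trans r1.
  - split.
    + move=> r; rewrite in_itv/= => /andP[r1 _].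
      by have [] := dF r (lt_trans (e0 k) r1).
    + by apply: cvg_at_right_filter; exact: cF.
    + by apply: cvg_at_left_filter; exact: cF.
  - move=> r; rewrite in_itv/= => /andP[r1 _]; rewrite derive1E.
    by have [_ ->] := dF r (lt_trans (e0 k) r1).
have ekE k : (e k `^ q = a `^ q * (1 + k.+1%:R) `^ (- q))%R.
  rewrite /e powRM ?invr_ge0 ?(ltW a0)// powRN; congr (_ * _)%R.
  by rewrite nat1r -powR_inv1// -powRrM mulN1r powRN.
have e_cvg0 : (e k `^ q)%R @[k --> \oo] --> (0 : R)%R.
  under eq_fun do rewrite ekE.
  have c1 : k.+1%:R @[k --> \oo] --> (+oo%R : set_system R).
    by apply: ger_cvgy cvgr_idn; near=> k; rewrite ler_nat.
  have c2 : ((1 + k.+1%:R) `^ (- q))%R @[k --> \oo] --> (0 : R)%R.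
    by have /cvg_pinftyP := powR_cvgy0 q0; apply.
  have c3 : (fun=> (a `^ q)%R) @ \oo --> (a `^ q)%R by exact: cvg_cst.
  have := cvgM c3 c2; rewrite mulr0; exact.
have Lr : ((a `^ q - e k `^ q) / q)%R @[k --> \oo] --> (a `^ q / q)%R.
  have c3 : (fun=> (a `^ q)%R) @ \oo --> (a `^ q)%R by exact: cvg_cst.
  have c4 : (fun=> (q^-1)%R) @ \oo --> (q^-1)%R by exact: cvg_cst.
  have c5 : (a `^ q - e k `^ q)%R @[k --> \oo] --> (a `^ q - 0)%R by exact: cvgB.
  by have := cvgM c5 c4; rewrite subr0; exact.
have L : \int[leb]_(r in `[e k, a]) (r `^ (q - 1))%:E @[k --> \oo] -->
    (a `^ q / q)%:E.
  under eq_fun do rewrite V.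
  by apply: cvg_EFin => //; near=> k.
by rewrite -(cvg_lim _ H)// (cvg_lim _ L).
Unshelve. all: by end_near. Qed.

End scaling.

(** * Radial functions along the rays through (1, u) *)

Lemma lipschitz_continuous {R : realType} (V : normedModType R) (f : V -> R)
    (k : R) : (forall u v, f u <= f v + `|u - v| * k) -> continuous f.
Proof.
move=> fk u; apply/cvgrPdist_lt => e e0.
have k1 : 0 < `|k| + 1 by rewrite ltr_wpDl.
near=> v.
have uv : `|u - v| < e / (`|k| + 1).
  by near: v; apply: cvgr_dist_lt; [exact: cvg_id|rewrite divr_gt0].
have uvk : `|u - v| * k < e.
  rewrite ltr_pdivlMr// in uv; apply: le_lt_trans uv.
  by rewrite ler_wpM2l// (le_trans (ler_norm k))// lerDl.
have h1 := fk u v; have h2 := fk v u; rewrite distrC in h2.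
rewrite ltr_norml; move: h1 h2 uvk.
set a := f u; set b := f v; set c := _ * k => h1 h2 uvk.
by apply/andP; split; lra.
Unshelve. all: by end_near. Qed.

Section radial.
Context {R : realType} {m : nat}.
Implicit Types (u v : 'rV[R]_m) (K : set 'rV[R]_m.+1).

Definition radial K u : R := sup [set r : R | 0 <= r /\ K (r *: rV_cons (1, u))].

Lemma rV_cons1_coord (r : R) u i : (r *: rV_cons (1, u)) ord0 i =
  if unlift ord0 i is Some j then r * u ord0 j else r.
Proof.
rewrite mxE; have [j ->|->] := unliftP ord0 i; first by rewrite rV_consS.
by rewrite rV_cons0 mulr1.
Qed.

Lemma ubody_scale K x (t : R) : ubody K -> 0 <= t -> t <= 1 -> K x -> K (t *: x).
Proof.
move=> bK t0 t1 Kx; have [_ cK _ _ _] := bK.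
by have := cK _ _ _ t0 t1 Kx (ubody0 bK); rewrite scaler0 addr0.
Qed.

Lemma radial_gt0_mem K u : ubody K ->
  0 < radial K u /\ K (radial K u *: rV_cons (1, u)).
Proof.
move=> bK; have [clK cK _ [r0 r00 Kr] [B KB]] := bK.
set S := [set r : R | 0 <= r /\ K (r *: rV_cons (1, u))].
have Sub : has_ubound S.
  exists B => r [_ /KB/(_ ord0)]; rewrite rV_cons1_coord unlift_none.
  exact: le_trans (ler_norm _).
(* The coordinates of s (1, u) are at most s (1 + |u|) = r0 in absolute value, so this point lies in
   the inscribed cube. *)
pose s := r0 / (1 + `|u|).
have n0 : 0 < 1 + `|u| by rewrite ltr_pwDl.
have s0 : 0 < s by rewrite divr_gt0.
have Ss : S s.
  split; first exact: ltW.
  apply: Kr => i; rewrite rV_cons1_coord; case: unlift => [j|]; rewrite /s.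
    rewrite normrM gtr0_norm// mulrAC ler_pdivrMr// ler_wpM2l ?(ltW r00)//.
    by rewrite (le_trans (row_coord_le u j))// lerDr.
  by rewrite gtr0_norm// ler_pdivrMr// ler_pMr// lerDl.
split; first by rewrite (lt_le_trans s0)// ub_le_sup.
have clS : closed S.
  rewrite (_ : S = [set r | 0 <= r] `&` (fun r => r *: rV_cons (1, u)) @^-1` K).
    apply: closedI; first exact: closed_ge.
    apply: closed_comp clK => r _.
    suff : continuous (fun r : R => r *: rV_cons (1, u)) by exact.
    apply: continuous_rowP => i.
    rewrite (_ : (fun _ => _) = (fun r => r * rV_cons (1, u) ord0 i)).
      exact: mulrr_continuous.
    by apply/funext => t; rewrite mxE.
  by apply/seteqP; split => r.
have /clS[] // : closure S (radial K u).
by apply: closure_sup => //; exists s.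
Qed.

Lemma radial_gt0 K u : ubody K -> 0 < radial K u.
Proof. by move=> bK; have [] := radial_gt0_mem u bK. Qed.

Lemma radialP K u (r : R) : ubody K -> 0 <= r ->
  K (r *: rV_cons (1, u)) <-> r <= radial K u.
Proof.
move=> bK r0; have [a0 Ka] := radial_gt0_mem u bK; split.
  move=> Kr; apply: ub_le_sup; last by split.
  have [_ _ _ _ [B KB]] := bK.
  exists B => t [_ /KB/(_ ord0)]; rewrite rV_cons1_coord unlift_none.
  exact: le_trans (ler_norm _).
move=> ra; have -> : r *: rV_cons (1, u) =
    (r / radial K u) *: (radial K u *: rV_cons (1, u)).
  by rewrite scalerA divfK// gt_eqF.
apply: ubody_scale => //; first by rewrite divr_ge0// ltW.
by rewrite ler_pdivrMr// mul1r.
Qed.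

Lemma radial_reflect K u i : ubody K ->
  radial K (reflect_coord i u) = radial K u.
Proof.
move=> bK; have [_ _ rK _ _] := bK; congr sup.
have E r : r *: rV_cons (1, reflect_coord i u) =
    reflect_coord (lift ord0 i) (r *: rV_cons (1, u)) :> 'rV[R]_m.+1.
  rewrite -reflect_rV_consS; apply/rowP => j; rewrite !mxE.
  by case: eqP => // _; rewrite mulrN.
apply/seteqP; split => r /= [r0 Kr]; split => //; last by rewrite E; exact: rK.
by have := rK (lift ord0 i) _ Kr; rewrite E reflect_coordK.
Qed.

(** The boundary point over [u] has all coordinates bounded by [B]; adding the bounds for coordinate
    0 and for the one carrying u_i gives [B + B]. This is the decay of [radial K] at infinity. *)
Lemma radial_bound K : ubody K ->
  exists B : R, 0 < B /\ forall u i, radial K u * (1 + `|u ord0 i|) <= B.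
Proof.
move=> bK; have [_ _ _ _ [B KB]] := bK.
have H u : K (radial K u *: rV_cons (1, u)) by have [] := radial_gt0_mem u bK.
have a0 u : 0 < radial K u := radial_gt0 u bK.
have B1 u : radial K u <= B.
  have := KB _ (H u) ord0; rewrite rV_cons1_coord unlift_none.
  exact: le_trans (ler_norm _).
exists (B + B); split; first by have := lt_le_trans (a0 0) (B1 0) => B0; rewrite addr_gt0.
move=> u i; rewrite mulrDr mulr1 lerD//.
have := KB _ (H u) (lift ord0 i); rewrite rV_cons1_coord liftK.
by rewrite normrM gtr0_norm.
Qed.

(* [1 / radial K] is the restriction of the gauge of [K] to the affine
   hyperplane [x_0 = 1]; a gauge is Lipschitz. *)
Lemma radial_inv_lipschitz K (r : R) u v : ubody K -> 0 < r ->
  (forall x : 'rV[R]_m.+1, (forall i, `|x ord0 i| <= r) -> K x) ->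
  (radial K u)^-1 <= (radial K v)^-1 + `|u - v| / r.
Proof.
move=> bK r0 Kr; have [_ cK _ _ _] := bK.
have au := radial_gt0 u bK; have [av Kv] := radial_gt0_mem v bK.
have [->|uv] := eqVneq u v; first by rewrite subrr normr0 mul0r addr0.
set d := `|u - v|; have d0 : 0 < d by rewrite normr_gt0 subr_eq0.
set s := radial K v in av Kv *.
pose w := s^-1 + d / r; have w0 : 0 < w by rewrite addr_gt0 ?invr_gt0 ?divr_gt0.
pose t := w^-1; have t0 : 0 < t by rewrite invr_gt0.
rewrite -/w -[leRHS]invrK lef_pV2 ?posrE ?invr_gt0//.
apply/(radialP u bK (ltW t0)).
have ts1 : t / s <= 1.
  by rewrite /t -invfM invf_le1 ?mulr_gt0// /w mulrDl mulVf ?gt_eqF// lerDl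
     mulr_ge0// ?divr_ge0// ltW.
have E : 1 - t / s = t * (d / r).
  apply/eqP; rewrite subr_eq addrC -mulrDr; apply/eqP.
  by rewrite -/w mulVf// gt_eqF.
have -> : t *: rV_cons (1, u) = (t / s) *: (s *: rV_cons (1, v)) +
    (1 - t / s) *: ((r / d) *: rV_cons (0, u - v)).
  rewrite E !scalerA divfK ?gt_eqF//.
  have -> : t * (d / r) * (r / d) = t.
    by rewrite -mulrA mulf_div (mulrC r) divff ?mulr1// mulf_neq0 ?gt_eqF.
  rewrite -scalerDr; congr (_ *: _); apply/rowP => i; rewrite [RHS]mxE.
  have [j ->|->] := unliftP ord0 i; last by rewrite !rV_cons0 addr0.
  by rewrite !rV_consS !mxE addrC subrK.
apply: cK => //; first by rewrite divr_ge0// ltW.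
apply: Kr => i; rewrite mxE; have [j ->|->] := unliftP ord0 i; last first.
  by rewrite rV_cons0 mulr0 normr0 ltW.
rewrite rV_consS normrM gtr0_norm ?divr_gt0// mulrAC ler_pdivrMr//.
by rewrite ler_pM2l// row_coord_le.
Qed.

Lemma continuous_radial K : ubody K -> continuous (radial K).
Proof.
move=> bK; have [_ _ _ [r r0 Kr] _] := bK.
have cV : continuous (fun u => (radial K u)^-1).
  apply: (@lipschitz_continuous _ _ _ r^-1) => u v.
  exact: radial_inv_lipschitz.
have -> : radial K = fun u => ((radial K u)^-1)^-1.
  by apply/funext => u; rewrite invrK.
have gen (T : topologicalType) (f : T -> R) : (forall t, f t != 0) ->
    continuous f -> continuous (fun t => (f t)^-1).
  by move=> f0 cf t; apply: cvgV; [exact: f0|exact: cf].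
by apply: gen => // u; rewrite invr_eq0 gt_eqF// radial_gt0.
Qed.

Lemma radial_dilate K (c : R) u : ubody K -> 0 < c ->
  radial [set c *: x | x in K] u = c * radial K u.
Proof.
move=> bK c0; have [a0 Ka] := radial_gt0_mem u bK.
set S := [set r : R | 0 <= r /\ [set c *: x | x in K] (r *: rV_cons (1, u))].
have ub : ubound S (c * radial K u).
  move=> r [r0 [x Kx xr]]; rewrite mulrC -ler_pdivrMr//.
  apply/(radialP u bK); first by rewrite divr_ge0// ltW.
  by rewrite mulrC -scalerA -xr scalerA mulVf ?scale1r// gt_eqF.
have Sc : S (c * radial K u).
  split; first by rewrite mulr_ge0// ltW.
  by exists (radial K u *: rV_cons (1, u)) => //; rewrite scalerA.
apply/eqP; rewrite eq_le; apply/andP; split.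
  by apply: ge_sup => //; exists (c * radial K u).
by apply: ub_le_sup => //; exists (c * radial K u).
Qed.

(** Reflections move [x] to the point [a] of the closed orthant. Coordinates of [a] may vanish, so
    [a] is approached along the segment to a constant positive vector of [K], and closedness of [L]
    gives the limit. *)
Lemma subset_dilate_pos K L (c : R) : ubody K -> ubody L -> 0 < c ->
  (forall x, pos_rV x -> K x -> L (c *: x)) -> forall x, K x -> L (c *: x).
Proof.
move=> bK bL c0 H x Kx.
have [_ cK rK [r r0 Kr] _] := bK; have [clL _ rL _ _] := bL.
have Kref i z : K (reflect_coord i z) = K z.
  by apply/propext; split => [/(rK i)|]; [rewrite reflect_coordK|exact: rK].
have Lref i z : L (reflect_coord i z) = L z.
  by apply/propext; split => [/(rL i)|]; [rewrite reflect_coordK|exact: rL].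
pose a : 'rV[R]_m.+1 := \row_i `|x ord0 i|.
have Ka : K a.
  by rewrite (@reflect_invariant _ _ _ K a x Kref)// => i; rewrite mxE normr_id.
suff La : L (c *: a).
  rewrite (@reflect_invariant _ _ _ L (c *: x) (c *: a) Lref)// => i.
  by rewrite !mxE !normrM normr_id.
apply: clL => B /nbhs_ballP[e /= e0 eB].
pose b : 'rV[R]_m.+1 := const_mx r.
have Kb : K b by apply: Kr => i; rewrite mxE gtr0_norm.
pose D := c * `|a - b|; have D0 : 0 <= D by rewrite mulr_ge0// ltW.
have eD : 0 < e + D by rewrite ltr_pwDl.
(* The displacement c t |a - b| is then e D / (e + D), which is less than e. *)
pose t := e / (e + D).
have t0 : 0 < t by rewrite divr_gt0.
have t1 : t <= 1 by rewrite ler_pdivrMr// mul1r lerDl.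
exists (c *: (t *: b + (1 - t) *: a)); split; last first.
  apply: eB; rewrite -ball_normE/= -scalerBr normrZ gtr0_norm//.
  rewrite (_ : a - _ = t *: (a - b)); last by apply/rowP => i; rewrite !mxE; ring.
  rewrite normrZ gtr0_norm// mulrCA -/D /t mulrAC ltr_pdivrMr// mulrDr.
  by rewrite ltr_pwDl// mulr_gt0.
apply: H; last exact: cK (ltW t0) t1 Kb Ka.
move=> i; rewrite !mxE; apply: ltr_pwDl; first exact: mulr_gt0.
by apply: mulr_ge0; rewrite ?subr_ge0.
Qed.

(** Equality in the Prekopa-Leindler inequality yields information over positive [u] only;
    [subset_dilate_pos], applied in both directions, extends it to the whole bodies. *)
Lemma radial_dilates K L (c : R) : ubody K -> ubody L -> 0 < c ->
  (forall u, pos_rV u -> radial L u = c * radial K u) ->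
  L = [set c *: x | x in K].
Proof.
move=> bK bL c0 LK.
have polar (x : 'rV[R]_m.+1) : pos_rV x -> exists u (r : R),
    [/\ pos_rV u, 0 < r & x = r *: rV_cons (1, u)].
  move=> x0; pose r := x ord0 ord0; have r0 : 0 < r := x0 ord0.
  exists (r^-1 *: (rV_uncons x).2), r; split => //.
    move=> i; rewrite mxE mulr_gt0 ?invr_gt0//.
    by have := x0 (lift ord0 i); rewrite -{1}(rV_unconsK x) rV_consS.
  by rewrite scale_rV_cons mulr1 scalerA mulfV ?gt_eqF// scale1r
    -[in LHS](rV_unconsK x).
apply/seteqP; split => [x Lx|_ [x Kx <-]].
  exists (c^-1 *: x); last by rewrite scalerA mulfV ?scale1r// gt_eqF.
  apply: (subset_dilate_pos bL bK) => //; first by rewrite invr_gt0.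
  move=> _ /polar[u [r [u0 r0 ->]]] /(radialP u bL (ltW r0)).
  rewrite LK// mulrC -ler_pdivrMr// => h; rewrite scalerA mulrC.
  by apply/(radialP u bK) => //; rewrite divr_ge0// ltW.
apply: (subset_dilate_pos bK bL) => // _ /polar[u [r [u0 r0 ->]]].
move=> /(radialP u bK (ltW r0)) h; rewrite scalerA.
by apply/(radialP u bL); rewrite ?LK ?mulr_ge0 ?ler_pM2l// ltW.
Qed.

End radial.

(** * The density on the hyperplane and its geometric-mean inequality *)

Section polar_density.
Context {R : realType} {m : nat}.
Implicit Types (u v : 'rV[R]_m) (K : set 'rV[R]_m.+1).
Variable q : R.
Hypotheses (q_gt0 : 0 < q) (q_lt : q < m.+1%:R) (m_gt0 : (0 < m)%N).

(** The exponent is halved because [1 + dotv u u] is the squared length of (1, u). The factor 1 / q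
    from radial integration is left out; it cancels against the [q] in [dual_quermass]. *)
Definition polar_density K u : R :=
  (1 + dotv u u) `^ ((q - m.+1%:R) / 2) * radial K u `^ q.

Let p_lt0 : (q - m.+1%:R) / 2 < 0.
Proof. by rewrite pmulr_llt0 ?invr_gt0// subr_lt0. Qed.

Lemma dotv_rV_cons1 u : dotv (rV_cons (1, u)) (rV_cons (1, u)) = 1 + dotv u u.
Proof.
rewrite /dotv big_ord_recl rV_cons0 mulr1; congr (_ + _).
by apply: eq_bigr => i _; rewrite rV_consS.
Qed.

Lemma enorm_powR n (x : 'rV[R]_n) (s : R) : enorm x `^ s = dotv x x `^ (s / 2).
Proof. by rewrite /enorm -powR12_sqrt ?dotv_ge0// -powRrM mulrC. Qed.

Lemma one_dotv_gt0 u : 0 < 1 + dotv u u.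
Proof. by rewrite ltr_pwDl// dotv_ge0. Qed.

Lemma le_powR_neg (p a b : R) : p <= 0 -> 0 < a -> a <= b -> b `^ p <= a `^ p.
Proof.
move=> p0 a0 ab; rewrite -[p]opprK !(powRN _ (- p)).
rewrite lef_pV2 ?posrE ?powR_gt0//; last exact: lt_le_trans ab.
by apply: le_powRl => //; [rewrite oppr_ge0|exact: ltW].
Qed.

Lemma lt_powR_neg (p a b : R) : p < 0 -> 0 < a -> a < b -> b `^ p < a `^ p.
Proof.
move=> p0 a0 ab; rewrite -[p]opprK !(powRN _ (- p)).
rewrite ltf_pV2 ?posrE ?powR_gt0//; last exact: lt_trans ab.
by apply: lt_powRl => //; [rewrite oppr_gt0|exact: ltW].
Qed.

(** [F u] is written as a product of [m] copies of its m-th root, and the i-th copy is bounded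
    through coordinate [i]; this divides the decay exponent by [m]. *)
Lemma good_of_coord_bound (F : 'rV[R]_m -> R) (s C : R) : 0 < C ->
  (forall u, 0 < F u) -> (forall u i, F u <= C * (1 + `|u ord0 i|) `^ (- s)) ->
  exists C', forall u, F u <= C' * decay_rV (s / m%:R) u.
Proof.
move=> C0 F0 FC; exists ((C `^ m%:R^-1) ^+ m) => u.
have mR : (0 : R) < m%:R by rewrite ltr0n.
have -> : F u = (F u `^ m%:R^-1) ^+ m.
  rewrite -powR_mulrn ?powR_ge0// -powRrM mulVf ?gt_eqF// powRr1//; exact: ltW.
have P (x : R) : x ^+ m = \prod_(i < m) x by rewrite prodr_const card_ord.
rewrite /decay_rV !P -big_split/=.
apply: ler_prod => i _; rewrite powR_ge0/=.
have -> : decay (s / m%:R) (u ord0 i) = ((1 + `|u ord0 i|) `^ (- s)) `^ m%:R^-1.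
  by rewrite /decay -powRrM mulNr.
rewrite -powRM ?powR_ge0 ?(ltW C0)//.
apply: le_powRl; [by rewrite invr_ge0 ltW|exact: ltW|exact: FC].
Qed.

(** With t = 1 + |u_i|, the two factors are bounded by multiples of t^(q - m - 1) and t^(- q), hence
    the density by a multiple of t^(- m - 1) for each i. This is the origin of the exponent (m + 1)
    / m. *)
Lemma good_polar_density K : ubody K ->
  good (m.+1%:R / m%:R) (polar_density K).
Proof.
move=> bK; have a0 u := radial_gt0 u bK.
have d0 u := one_dotv_gt0 u.
have F0 u : 0 < polar_density K u by rewrite mulr_gt0// powR_gt0.
split; [|exact: F0| |].
- have cM (T : topologicalType) (f g : T -> R) :
      continuous f -> continuous g -> continuous (fun t => f t * g t).
    by move=> cf cg t; apply: cvgM; [exact: cf|exact: cg].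
  have cA (T : topologicalType) (f : T -> R) :
      continuous f -> continuous (fun t => 1 + f t).
    by move=> cf t; apply: cvgD; [exact: cvg_cst|exact: cf].
  apply: cM; apply: continuous_powRl => //; last exact: continuous_radial.
  by apply: cA; apply: continuous_dotv => u; exact: cvg_id.
- move=> i u; rewrite /polar_density radial_reflect//.
  by rewrite dotv_reflect reflect_coordK.
have [B [B0 KB]] := radial_bound bK.
(* The constant 1 / 2 comes from (1 + |u_i|)^2 <= 2 (1 + u_i^2). *)
apply: (@good_of_coord_bound _ _ ((2^-1) `^ ((q - m.+1%:R) / 2) * B `^ q)) => //.
  by rewrite mulr_gt0// powR_gt0.
move=> u i; set t := 1 + `|u ord0 i|.
have t0 : 0 < t by rewrite ltr_pwDl.
have tE : t `^ (- m.+1%:R) = (t ^+ 2) `^ ((q - m.+1%:R) / 2) * t `^ (- q).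
  rewrite -powR_mulrn ?(ltW t0)// -powRrM -powRD; last first.
    by rewrite (gt_eqF t0) implybT.
  by congr (_ `^ _); rewrite mulrC divfK// addrAC subrr add0r.
rewrite tE mulrACA; apply: ler_pM; rewrite ?powR_ge0//.
  rewrite -powRM ?invr_ge0 ?sqr_ge0//; apply: le_powR_neg; first exact: ltW.
    by rewrite mulr_gt0 ?invr_gt0// exprn_gt0.
  have ui : `|u ord0 i| ^+ 2 <= dotv u u.
    rewrite /dotv (bigD1 i)//= -[leLHS]addr0 lerD//.
      by rewrite -normrX -expr2 ger0_norm// sqr_ge0.
    by apply: sumr_ge0 => j _; rewrite -expr2 sqr_ge0.
  apply: (@le_trans _ _ (1 + `|u ord0 i| ^+ 2)); last by rewrite lerD2l.
  rewrite ler_pdivrMl// /t; have := sqr_ge0 (1 - `|u ord0 i|); nra.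
rewrite powRN ler_pdivlMr ?powR_gt0// -powRM ?(ltW (a0 u)) ?(ltW t0)//.
apply: le_powRl; [exact: ltW| |exact: KB].
by rewrite mulr_ge0 ?ltW.
Qed.

Lemma tau_gt1 : 1 < m.+1%:R / m%:R :> R.
Proof. by rewrite ltr_pdivlMr ?ltr0n// mul1r ltr_nat. Qed.

Lemma ubody_measurable K : ubody K -> measurable K.
Proof.
case=> clK _ _ _ _; rewrite -[K]setCK; apply: measurableC.
by apply: open_measurable_rV; exact: closed_openC.
Qed.

(** On the ray through (1, u) the integrand times r^m is (1 + |u|^2)^((q - m - 1) / 2) r^(q - 1),
    and [K] cuts the ray at [radial K u]. The origin, where the power takes its default value, is
    not on the open ray. *)
Lemma dual_quermass_polar K : ubody K ->
  dual_quermass q K = 2 / m.+1%:R * \int[lebesgue_rV m]_u polar_density K u.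
Proof.
move=> bK; have [_ _ rK _ _] := bK.
have Kref i x : K (reflect_coord i x) = K x.
  by apply/propext; split => [/(rK i)|]; [rewrite reflect_coordK|exact: rK].
pose g (x : 'rV[R]_m.+1) : \bar R := (enorm x `^ (q - m.+1%:R))%:E.
have g0 x : (0 <= g x)%E by rewrite lee_fin powR_ge0.
pose G := g \_ K.
have mg : measurable_fun [set: 'rV[R]_m.+1] g.
  apply/measurable_EFinP; apply: (@measurableT_comp _ _ _ _ _ _
    (fun t : R => t `^ (q - m.+1%:R))); first exact: measurable_powR.
  apply: continuous_measurable_rV => x.
  suff : {for x, continuous (Num.sqrt \o (fun x : 'rV[R]_m.+1 => dotv x x))} by [].
  apply: continuous_comp; last exact: sqrt_continuous.
  by apply: continuous_dotv => y; exact: cvg_id.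
have GE x : G x = if x \in K then g x else 0%E by rewrite /G patchE.
have E : (\int[lebesgue_rV m.+1]_(x in K) g x)%E =
    (2%:E * \int[lebesgue_rV m]_u ((q^-1)%:E * (polar_density K u)%:E))%E.
  rewrite integral_mkcond (@integral_polar _ _ G); last 3 first.
  - by apply/(measurable_restrictT g (ubody_measurable bK)); exact: measurable_funTS.
  - by move=> x; apply: erestrict_ge0 => y _; exact: g0.
  - move=> x; rewrite /G !patchE /g enorm_reflect.
    by congr (if _ then _ else _); apply/idP/idP; rewrite !inE Kref.
  congr (_ * _)%E; apply: eq_integral => u _.
  have [a0 Ka] := radial_gt0_mem u bK.
  transitivity (\int[@lebesgue_measure R]_(r in `]0%R, radial K u])
      (((1 + dotv u u) `^ ((q - m.+1%:R) / 2))%:E * (r `^ (q - 1))%:E))%E.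
    rewrite integral_mkcond [RHS]integral_mkcond; apply: eq_integral => r _.
    rewrite patchE [RHS]patchE !mem_setE !in_itv/= andbT.
    have [r0|//] := ltP 0 r; rewrite /= GE.
    have -> : (r *: rV_cons (1, u) \in K) = (r <= radial K u).
      by apply/idP/idP; rewrite inE => /(radialP u bK (ltW r0)).
    case: ifPn => _; last by rewrite mule0.
    rewrite /g -!EFinM enorm_powR dotvZl dotvC dotvZl dotv_rV_cons1; congr EFin.
    rewrite mulrA -expr2 powRM ?sqr_ge0 ?(ltW (one_dotv_gt0 u))//.
    rewrite mulrA mulrC; congr (_ * _).
    rewrite -!powR_mulrn ?(ltW r0)// -powRrM -powRD; last first.
      by rewrite (gt_eqF r0) implybT.
    by congr (_ `^ _); rewrite -natr1; field.
  have mI : measurable (`]0%R, radial K u]%classic : set (measurableTypeR R)) by [].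
  rewrite (@ge0_integralZl_EFin _ (measurableTypeR R) R (@lebesgue_measure R) _ mI
    (fun r => (r `^ (q - 1))%:E)); last 3 first.
  - by move=> r _; rewrite lee_fin powR_ge0.
  - by apply/measurable_EFinP; apply: measurable_funTS; exact: measurable_powR.
  - exact: powR_ge0.
  rewrite integral_powR// -!EFinM; congr EFin.
  by rewrite /polar_density; ring.
rewrite /dual_quermass /Rintegral E ge0_integralZl_EFin//; last 3 first.
- by move=> u _; rewrite lee_fin mulr_ge0// powR_ge0.
- apply/measurable_EFinP; apply: continuous_measurable_rV.
  by have [] := good_polar_density bK.
- by rewrite invr_ge0 ltW.
rewrite (integral_good_lty tau_gt1 (good_polar_density bK)) -!EFinM/=.
have q0 : q != 0 by rewrite gt_eqF.
have m1 : (m.+1%:R : R) != 0 by rewrite pnatr_eq0.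
set J := \int[lebesgue_rV m]_u _; move: (m.+1%:R : R) m1 => M m1.
by field; rewrite q0 m1.
Qed.

Section geometric_mean_density.
Variable l : R.
Hypotheses (l_gt0 : 0 < l) (l_lt1 : l < 1).

Lemma one_dotv_gm u v : pos_rV u -> pos_rV v ->
  1 + dotv (gm_rV l u v) (gm_rV l u v) <= gm l (1 + dotv u u) (1 + dotv v v).
Proof.
move=> u0 v0; rewrite -!dotv_rV_cons1 /dotv.
have sq_ge0 (w : 'rV[R]_m) i : 0 <= rV_cons (1, w) ord0 i * rV_cons (1, w) ord0 i.
  by rewrite -expr2 sqr_ge0.
apply: (le_trans _ (sum_gm_le l_gt0 l_lt1 (sq_ge0 u) (sq_ge0 v))).
apply: ler_sum => i _.
have c0 (w : 'rV[R]_m) : pos_rV w -> 0 < rV_cons (1, w) ord0 i.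
  by move=> w0; exact: pos_rV_cons.
rewrite gmM ?(ltW (c0 _ u0)) ?(ltW (c0 _ v0))//.
have -> : rV_cons (1, gm_rV l u v) ord0 i =
    gm l (rV_cons (1, u) ord0 i) (rV_cons (1, v) ord0 i).
  by rewrite -{1}(gmxx l_lt1 ler01) -gm_rV_cons mxE.
exact: lexx.
Qed.

(** The first coordinate 1 of both points is the shared entry asked for by [sum_gm_lt], applied to
    squared coordinates; positive coordinates with equal squares are equal. *)
Lemma one_dotv_gm_lt u v : pos_rV u -> pos_rV v -> u <> v ->
  1 + dotv (gm_rV l u v) (gm_rV l u v) < gm l (1 + dotv u u) (1 + dotv v v).
Proof.
move=> u0 v0 uv; rewrite -!dotv_rV_cons1 /dotv.
have c0 (w : 'rV[R]_m) i : pos_rV w -> 0 < rV_cons (1, w) ord0 i.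
  by move=> w0; exact: pos_rV_cons.
have sq_gt0 (w : 'rV[R]_m) : pos_rV w -> forall i,
    0 < rV_cons (1, w) ord0 i * rV_cons (1, w) ord0 i.
  by move=> w0 i; rewrite mulr_gt0 ?c0.
apply: (le_lt_trans _ (@sum_gm_lt _ l l_gt0 l_lt1 _ _ _ ord0 (sq_gt0 _ u0)
  (sq_gt0 _ v0) _ _)); last 2 first.
- by rewrite !rV_cons0.
- apply: contrapT => /forallNP H; apply: uv; apply/rowP => i.
  have /negP := H (lift ord0 i); rewrite negbK !rV_consS -!expr2.
  by rewrite eqrXn2 ?(ltW (u0 _)) ?(ltW (v0 _))// => /eqP.
apply: ler_sum => i _; rewrite gmM ?(ltW (c0 _ _ _))//.
have -> : rV_cons (1, gm_rV l u v) ord0 i =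
    gm l (rV_cons (1, u) ord0 i) (rV_cons (1, v) ord0 i).
  by rewrite -{1}(gmxx l_lt1 ler01) -gm_rV_cons mxE.
exact: lexx.
Qed.

Variables K L : set 'rV[R]_m.+1.
Hypotheses (bK : ubody K) (uK : unconditional K) (bL : ubody L) (uL : unconditional L).

(** Since [gm l 1 1 = 1], the coordinatewise mean of the boundary points over [u] and [v] lies on
    the ray over [gm_rV l u v], at the parameter on the left-hand side. *)
Lemma radial_L0_sum u v : pos_rV u -> pos_rV v ->
  gm l (radial K u) (radial L v) <= radial (L0_sum l K L) (gm_rV l u v).
Proof.
move=> u0 v0.
have bM := L0_sum_ubody l_gt0 l_lt1 bK uK bL uL.
have [aK Ku] := radial_gt0_mem u bK; have [aL Lv] := radial_gt0_mem v bL.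
apply/(radialP _ bM (gm_ge0 l _ _)).
have P (w : 'rV[R]_m) (a : R) : 0 < a -> pos_rV w -> pos_rV (a *: rV_cons (1, w)).
  by move=> a0 w0 i; rewrite mxE mulr_gt0//; exact: pos_rV_cons.
have := gm_rV_L0_sum l_gt0 l_lt1 bK uK bL uL Ku Lv (P _ _ aK u0) (P _ _ aL v0).
rewrite (_ : gm_rV l _ _ = gm l (radial K u) (radial L v) *: rV_cons (1, gm_rV l u v)) //.
apply/rowP => i; rewrite mxE !rV_cons1_coord.
case: unlift => // j; rewrite mxE gmM ?(ltW aK) ?(ltW aL)//; exact: ltW.
Qed.

Lemma polar_density_L0_sum u v : pos_rV u -> pos_rV v ->
  gm l (polar_density K u) (polar_density L v) <=
  polar_density (L0_sum l K L) (gm_rV l u v).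
Proof.
move=> u0 v0; have aK := radial_gt0 u bK; have aL := radial_gt0 v bL.
rewrite /polar_density gmM ?powR_ge0// !gm_powR; apply: ler_pM; rewrite ?powR_ge0//.
  apply: le_powR_neg; [exact: ltW|exact: one_dotv_gt0|exact: one_dotv_gm].
apply: le_powRl; [exact: ltW|exact: gm_ge0|exact: radial_L0_sum].
Qed.

(** All strictness comes from the factor in [1 + dotv u u], where the negative exponent reverses
    [one_dotv_gm_lt]; the radial factor contributes a weak inequality. *)
Lemma polar_density_L0_sum_lt u v : pos_rV u -> pos_rV v -> u <> v ->
  gm l (polar_density K u) (polar_density L v) <
  polar_density (L0_sum l K L) (gm_rV l u v).
Proof.
move=> u0 v0 uv; have aK := radial_gt0 u bK; have aL := radial_gt0 v bL.
rewrite /polar_density gmM ?powR_ge0// !gm_powR.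
have H : gm l (radial K u) (radial L v) `^ q <=
    radial (L0_sum l K L) (gm_rV l u v) `^ q.
  apply: le_powRl; [exact: ltW|exact: gm_ge0|exact: radial_L0_sum].
apply: lt_le_trans (ler_wpM2l (powR_ge0 _ _) H).
rewrite ltr_pM2r; last by rewrite powR_gt0// gm_gt0.
apply: lt_powR_neg; [exact: p_lt0|exact: one_dotv_gt0|exact: one_dotv_gm_lt].
Qed.

End geometric_mean_density.

End polar_density.

(** * Homogeneity, the inequality and its equality case *)

Lemma dual_quermass_dilate {R : realType} {m : nat} (q c : R) (K : set 'rV[R]_m.+1) :
  0 < q -> q < m.+1%:R -> (0 < m)%N -> 0 < c -> ubody K ->
  ubody [set c *: x | x in K] ->
  dual_quermass q [set c *: x | x in K] = c `^ q * dual_quermass q K.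
Proof.
move=> q0 qm m0 c0 bK bcK; rewrite !dual_quermass_polar// mulrCA; congr (_ * _).
rewrite -RintegralZl//; last first.
  exact: (good_integrable (tau_gt1 m0) (good_polar_density q0 qm m0 bK)).
apply: eq_Rintegral => u _; rewrite /polar_density radial_dilate//.
by rewrite powRM ?(ltW c0) ?(ltW (radial_gt0 _ bK))// mulrCA.
Qed.

Theorem theorem1p3 (R : realType) (n : nat) (hn : (2 <= n)%N)
  (q : R) (hq0 : 0 < q) (hqn : q < n%:R) (K L : set 'rV[R]_n)
  (bodyK : convex_body K) (uncK : unconditional K)
  (bodyL : convex_body L) (uncL : unconditional L)
  (l : R) (hl0 : 0 < l) (hl1 : l < 1) :
  dual_quermass q K `^ (1 - l) * dual_quermass q L `^ l
    <= dual_quermass q (L0_sum l K L)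
  /\
  (dual_quermass q (L0_sum l K L)
     = dual_quermass q K `^ (1 - l) * dual_quermass q L `^ l
   <-> dilates K L).
Proof.
case: n hn hqn K L bodyK uncK bodyL uncL => [//|m] hn hqn K L bodyK uncK bodyL uncL.
(* The hyperplane has dimension m = n - 1 >= 1, so the decay exponent (m + 1) / m is meaningful. *)
have m0 : (0 < m)%N by [].
have bK := convex_body_ubody bodyK uncK; have bL := convex_body_ubody bodyL uncL.
have bM := L0_sum_ubody hl0 hl1 bK uncK bL uncL.
have gK := good_polar_density hq0 hqn m0 bK.
have gL := good_polar_density hq0 hqn m0 bL.
have gM := good_polar_density hq0 hqn m0 bM.
have [PL _ PLeq] := prekopa_leindler_rV hl0 hl1 (tau_gt1 m0) gK gL gM
  (polar_density_L0_sum hq0 hqn hl0 hl1 bK uncK bL uncL).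
have dqK := dual_quermass_polar hq0 hqn m0 bK.
have dqL := dual_quermass_polar hq0 hqn m0 bL.
have dqM := dual_quermass_polar hq0 hqn m0 bM.
have IK0 := Rintegral_good_gt0 (tau_gt1 m0) gK.
have IL0 := Rintegral_good_gt0 (tau_gt1 m0) gL.
have c0 : 0 < 2 / m.+1%:R :> R by rewrite divr_gt0.
rewrite -/(gm l (dual_quermass q K) (dual_quermass q L)).
have E : gm l (dual_quermass q K) (dual_quermass q L) = 2 / m.+1%:R *
    gm l (\int[lebesgue_rV m]_u polar_density q K u)
         (\int[lebesgue_rV m]_u polar_density q L u).
  by rewrite dqK dqL (gmZ hl1 (ltW c0) (ltW IK0) (ltW IL0)).
split; first by rewrite E dqM (ler_pM2l c0); exact: PL.
split => [|[c cgt0 LE]].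
  rewrite E dqM => /(mulfI (lt0r_neq0 c0)) eqM.
  have FE := PLeq (polar_density_L0_sum_lt hq0 hqn hl0 hl1 bK uncK bL uncL) eqM.
  have [k k0 {}FE] : exists2 k : R, 0 < k & forall u, pos_rV u ->
      polar_density q L u = k * polar_density q K u.
    eexists; first exact: divr_gt0 IL0 IK0.
    move=> u /FE ->; rewrite mulrA mulf_div [X in X / _]mulrC divff ?mul1r//.
    exact: mulf_neq0 (lt0r_neq0 IK0) (lt0r_neq0 IL0).
  (* The densities share the factor in [1 + dotv u u], so [k] is the q-th power of the ratio of the
     radial functions. *)
  have kq0 : 0 < k `^ q^-1 by exact: powR_gt0.
  exists (k `^ q^-1) => //; apply: radial_dilates => // u u0.
  have aK := radial_gt0 u bK; have aL := radial_gt0 u bL.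
  have aE : radial L u `^ q = k * radial K u `^ q.
    have := FE u u0; rewrite /polar_density mulrCA; apply: mulfI.
    by rewrite gt_eqF// powR_gt0// one_dotv_gt0.
  have root (a : R) : 0 < a -> a = (a `^ q) `^ q^-1.
    by move=> a0; rewrite -powRrM divff ?gt_eqF// powRr1// ltW.
  rewrite [LHS](root _ aL) aE (powRM _ (ltW k0) (powR_ge0 _ _)).
  by rewrite -(root _ aK).
(* Conversely, the L_0-sum of [K] and c K is c^l K; by homogeneity of degree [q] both sides equal
   c^(l q) times the value at [K]. *)
have ME : L0_sum l K L = [set c `^ l *: x | x in K] by rewrite LE L0_sum_dilate.
have k0 : 0 < c `^ l by exact: powR_gt0.
have bcK : ubody [set c *: x | x in K] by rewrite -LE.
have bkK : ubody [set c `^ l *: x | x in K] by rewrite -ME.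
rewrite ME LE (dual_quermass_dilate hq0 hqn m0 k0 bK bkK).
rewrite (dual_quermass_dilate hq0 hqn m0 cgt0 bK bcK).
have dqK0 : 0 <= dual_quermass q K.
  by rewrite dqK; exact: mulr_ge0 (ltW c0) (ltW IK0).
by rewrite (gm_mulr hl1 dqK0 (powR_ge0 _ _)) powRAC.
Qed.
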